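(* Fix $\beta\ge 0$, an integer $n\ge1$, $m\in\{1,\dots,n\}$ and $\alpha\in[1,2n+1)$. The following two statements are equivalent. (1) For every Borel set $A\subseteq\mathbb{H}^n$ with $\dim_E A>\alpha$, $\dim_{\mathbb{V}\backslash\mathbb{H}^n}P^R_{\mathbb{V}^\perp}(A)\ge\beta$ for $\mu_{n,m}$-a.e. $V\in G_h(n,m)$. (2) For every Borel set $A\subseteq\mathbb{H}^n$ with $\dim_E A>\alpha$, $\dim_E P^R_{\mathbb{V}^\perp}(A)\ge\beta$ for $\mu_{n,m}$-a.e. $V\in G_h(n,m)$.
   Context: The Heisenberg group $\mathbb{H}^n$ is $\mathbb{R}^{2n}\times\mathbb{R}$, with points $(z,t)$, $z=(x_1,\dots,x_n,y_1,\dots,y_n)$, and group law $(z,t)*(w,s)=(z+w,\,t+s+\tfrac12\omega(z,w))$, where for $w=(u_1,\dots,u_n,v_1,\dots,v_n)$, $\omega(z,w)=\sum_{j=1}^n(x_jv_j-y_ju_j)$. Let $X_j=\partial_{x_j}-\tfrac{y_j}{2}\partial_t$, $Y_j=\partial_{y_j}+\tfrac{x_j}{2}\partial_t$ ($1\le j\le n$). The Carnot–Carathéodory metric $d_{cc}(p,q)$ is the infimum of $\int_0^1(\sum_j a_j^2+b_j^2)^{1/2}ds$ over absolutely continuous curves $\gamma:[0,1]\to\mathbb{H}^n$ from $p$ to $q$ with $\dot\gamma=\sum_j a_jX_j+b_jY_j$ a.e.; it is bi-Lipschitz equivalent to the Korányi metric $d_{\mathbb{H}^n}(p,q)=\|q^{-1}*p\|$,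 $\|(z,t)\|^4=|z|^4+16t^2$. $G_h(n,m)$ is the set of $m$-dimensional isotropic linear subspaces $V$ of $\mathbb{R}^{2n}\cong\mathbb{C}^n$ (i.e. $\omega$ vanishes on $V\times V$), and $\mu_{n,m}$ is the unique probability measure on $G_h(n,m)$ invariant under the unitary group $U(n)$. For $V\in G_h(n,m)$ put $\mathbb{V}=V\times\{0\}$, $\mathbb{V}^\perp=V^\perp\times\mathbb{R}$. Let $P_{\mathbb{V}}(z,t)=(\pi_V(z),0)$, where $\pi_V$ is Euclidean orthogonal projection onto $V$, and let $P^R_{\mathbb{V}^\perp}:\mathbb{H}^n\to\mathbb{V}^\perp$, $P^R_{\mathbb{V}^\perp}(p)=P_{\mathbb{V}}(p)^{-1}*p$. On $\mathbb{V}^\perp$ (identified with the space of right cosets $\mathbb{V}\backslash\mathbb{H}^n$ via $\mathbb{V}q\mapsto q$) the quotient metric is $d_{\mathbb{V}\backslash\mathbb{H}^n}(p,p')=\inf_{q\in\mathbb{V}}d_{cc}(q*p,p')$. The notations $\dim_E$ and $\dim_{\mathbb{V}\backslash\mathbb{H}^n}$ denote Hausdorff dimension with respect to the Euclidean metric and $d_{\mathbb{V}\backslash\mathbb{H}^n}$ respectively. *)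

(* Defs.v *)
From HB Require Import structures.
From mathcomp Require Import all_boot all_order all_algebra spectral.
From mathcomp Require Import complex.
From mathcomp Require Import all_classical all_reals all_analysis.

Set Implicit Arguments.
Unset Strict Implicit.
Unset Printing Implicit Defensive.
Import Order.TTheory GRing.Theory Num.Theory.
Import numFieldNormedType.Exports.
Local Open Scope classical_set_scope.
Local Open Scope ring_scope.

Section hausdorff.
Context {R : realType} {T : Type}.
Variable d : T -> T -> \bar R.
Implicit Types (A U : set T) (s delta : R).

Definition diam U : \bar R := ereal_sup [set d xy.1 xy.2 | xy in U `*` U].

(* Covers by arbitrary subsets of T: intersecting them with A changes no bound,
   so only the values of d on A x A matter.
   Empty pieces contribute 0, and 0 `^ 0 = 1. *)
Definition hausdorff_content s delta A : \bar R :=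
  ereal_inf [set (\sum_(0 <= k <oo | C k != set0) poweR (diam (C k)) s)%E |
    C in [set C : (set T)^nat | A `<=` \bigcup_k C k /\
                                forall k, (diam (C k) <= delta%:E)%E]].

Definition hausdorff_measure s A : \bar R :=
  ereal_sup [set hausdorff_content s delta A | delta in [set delta | 0 < delta]].

Definition hausdorff_dim A : \bar R :=
  ereal_inf [set s%:E | s in [set s | 0 <= s /\ hausdorff_measure s A = 0%E]].

End hausdorff.

Section absolute_continuity.
Context {R : realType} {W : normedModType R}.

Definition absolutely_continuous (a b : R) (f : R -> W) : Prop :=
  forall e : R, 0 < e -> exists2 delta : R, 0 < delta &
    forall (k : nat) (u v : 'I_k -> R),
      (forall i, a <= u i /\ u i <= v i /\ v i <= b) ->
      trivIset [set: 'I_k] (fun i => `]u i, v i[%classic) ->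
      \sum_i (v i - u i) < delta ->
      \sum_i `|f (v i) - f (u i)| < e.

End absolute_continuity.

Section dot_product.
Context {R : realType} {k : nat}.
Implicit Types u v : 'rV[R]_k.

Definition dot u v : R := \sum_(i < k) u 0 i * v 0 i.

Let dot_linearl v : linear_for *%R (dot^~ v).
Proof.
by move=> c u w /=; rewrite /dot mulr_sumr -big_split; apply: eq_bigr => i _;
  rewrite !mxE mulrDl mulrA.
Qed.

Let dot_linearr u : linear_for ((@idfun R : R -> R) \; *%R) (dot u).
Proof.
by move=> c v w /=; rewrite /dot mulr_sumr -big_split; apply: eq_bigr => i _;
  rewrite !mxE mulrDr mulrCA.
Qed.

Let dot_bilinear : bilinear_for *%R ((@idfun R : R -> R) \; *%R) dot.
Proof. by split => u; [exact: dot_linearl|exact: dot_linearr]. Qed.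

HB.instance Definition _ :=
  bilinear_isBilinear.Build R _ _ R *%R ((@idfun R : R -> R) \; *%R) dot
    dot_bilinear.

Let dot_sym u v : dot u v = (-1) ^+ false * idfun (dot v u).
Proof. by rewrite mul1r; apply: eq_bigr => i _; rewrite mulrC. Qed.

HB.instance Definition _ := isHermitianSesquilinear.Build R _ _ _ dot dot_sym.

End dot_product.

(* Row vectors z : 'rV_(n + n) are split as z = (x, y), with x = lsubmx z and
   y = rsubmx z. *)
Definition heis (R : realType) (n : nat) : normedModType R :=
  ('rV[R]_(n + n) * R)%type.

Section heisenberg.
Context {R : realType} {n : nat}.
Local Notation vec := 'rV[R]_(n + n).
Local Notation H := (heis R n).
Implicit Types (z w : vec) (p q : H) (V : {vspace vec}).

Definition omega z w : R :=
  \sum_(j < n) (lsubmx z 0 j * rsubmx w 0 j - rsubmx z 0 j * lsubmx w 0 j).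

Definition heis_mul p q : H := (p.1 + q.1, p.2 + q.2 + omega p.1 q.1 / 2).
Definition heis_inv p : H := (- p.1, - p.2).

Definition eucl_dist p q : \bar R :=
  (Num.sqrt (dot (p.1 - q.1) (p.1 - q.1) + (p.2 - q.2) ^+ 2))%:E.

Definition Xfield (j : 'I_n) p : H :=
  (row_mx (delta_mx 0 j) 0, - rsubmx p.1 0 j / 2).
Definition Yfield (j : 'I_n) p : H :=
  (row_mx 0 (delta_mx 0 j), lsubmx p.1 0 j / 2).

Definition horizontal_curve (g : R -> H) (a b : 'I_n -> R -> R) : Prop :=
  [/\ absolutely_continuous 0 1 g,
      forall j, measurable_fun (`[0, 1] : set R) (a j) /\
                measurable_fun (`[0, 1] : set R) (b j) &
      {ae (@lebesgue_measure R), forall s : R, s \in `[0, 1]%R ->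
        is_derive s 1 g
          (\sum_(j < n) (a j s *: Xfield j (g s) + b j s *: Yfield j (g s)))}].

Definition horizontal_length (a b : 'I_n -> R -> R) : \bar R :=
  (\int[@lebesgue_measure R]_(s in (`[0%R, 1%R] : set R))
     (Num.sqrt (\sum_(j < n) (a j s ^+ 2 + b j s ^+ 2)))%:E)%E.

Definition dcc p q : \bar R :=
  ereal_inf [set l | exists g a b,
    [/\ horizontal_curve g a b, g 0 = p, g 1 = q & l = horizontal_length a b]].

Definition isotropic V : Prop := {in V &, forall z w, omega z w = 0}.

Definition orth_proj V : 'End(vec) := daddv_pi V (orthov (@dot R (n + n)) V).

Definition hsub V : set H := [set p | p.1 \in V /\ p.2 = 0].

Definition hproj V p : H := (orth_proj V p.1, 0).

Definition vproj V p : H := heis_mul (heis_inv (hproj V p)) p.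

Definition quotient_dist V p q : \bar R :=
  ereal_inf [set dcc (heis_mul h p) q | h in hsub V].

End heisenberg.

Section isotropic_grassmannian.
Context {R : realType} {n m : nat}.

(* The bound m <= n makes the type inhabited, as measurableType requires. *)
Definition Gh (mn : (m <= n)%N) : Type :=
  {V : {vspace 'rV[R]_(n + n)} | `[< isotropic V /\ \dim V = m >]}.

Variable mn : (m <= n)%N.

Lemma Gh_nonempty : exists V : {vspace 'rV[R]_(n + n)},
  `[< isotropic V /\ \dim V = m >].
Proof.
pose f := linfun (mulmxr (row_mx (pid_mx m) 0) : 'rV[R]_m -> 'rV[R]_(n + n)).
exists (limg f); apply/asboolP; split.
  move=> _ _ /memv_imgP[u _ ->] /memv_imgP[v _ ->].
  rewrite /omega big1// => j _.
  rewrite !lfunE/= !mul_mx_row !row_mxKl !row_mxKr !mulmx0 !mxE.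
  by rewrite mulr0 mul0r subr0.
suff kf0 : lker f = 0%VS.
  by rewrite limg_dim_eq ?kf0 ?capv0// dimvf dim_matrix ?mul1r ?mul1n.
apply/eqP; rewrite -subv0; apply/subvP => u; rewrite memv_ker memv0 lfunE/=.
rewrite mul_mx_row => /eqP/(congr1 (@lsubmx _ _ n n)).
rewrite row_mxKl linear0 => /(congr1 (mulmx^~ (pid_mx m : 'M[R]_(n, m)))) h.
apply/eqP; move: h.
by rewrite -mulmxA pid_mx_id// pid_mx_1 mulmx1 mul0mx.
Qed.

HB.instance Definition _ := Choice.on (Gh mn).
HB.instance Definition _ := isPointed.Build (Gh mn)
  (let: exist V hV := cid Gh_nonempty in exist _ V hV).

(* The open sets of the topology induced by V |-> orth_proj V. *)
Definition Gh_open : set (set (Gh mn)) :=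
  [set (fun V : Gh mn => lin1_mx (orth_proj (val V))) @^-1` O | O in open].

Definition GhBorel := g_sigma_algebraType Gh_open.

Definition Gh_space (V : GhBorel) : {vspace 'rV[R]_(n + n)} := val V.

(* Right multiplication by U on C^n, under z = (x, y) <-> x + i y:
   (x + i y)(P + i Q) = (x P - y Q) + i (x Q + y P). *)
Definition realify (U : 'M[R[i]]_n) : 'M[R]_(n + n) :=
  let P := map_mx (@complex.Re R) U in
  let Q := map_mx (@complex.Im R) U in block_mx P Q (- Q) P.

Definition unitary_image (U : 'M[R[i]]_n) (V : {vspace 'rV[R]_(n + n)}) :=
  (linfun (mulmxr (realify U) : 'rV[R]_(n + n) -> _) @: V)%VS.

Definition unitary_invariant (mu : probability GhBorel R) : Prop :=
  forall U : 'M[R[i]]_n, U \is unitarymx ->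
  forall S : set GhBorel, measurable S ->
    mu [set W | exists2 V, S V & Gh_space W = unitary_image U (Gh_space V)]
      = mu S.

End isotropic_grassmannian.
Arguments Gh : clear implicits.
Arguments Gh R {n m} mn.
Arguments GhBorel R {n m} mn.
Arguments Gh_space {R n m mn} V.

(* Main.v *)
Require Import Defs.
From HB Require Import structures.
From mathcomp Require Import all_boot all_order all_algebra spectral.
From mathcomp Require Import complex.
From mathcomp Require Import all_classical all_reals all_analysis.
From mathcomp Require Import measurable_realfun ring lra.
Import Order.TTheory GRing.Theory Num.Theory.
Import numFieldNormedType.Exports.
Local Open Scope classical_set_scope.
Local Open Scope ring_scope.
Set Implicit Arguments.
Unset Strict Implicit.
Unset Printing Implicit Defensive.

(** On bounded subsets of [V^perp x R] the Euclidean distance is at most a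
    constant times the quotient distance, because a horizontal curve of length
    [L] changes the height relative to its starting point by [O(L^2)] only.
    Hence the Euclidean dimension never exceeds the quotient dimension, and (2)
    implies (1).

    Conversely the two distances are locally equivalent near a point [(w, t)]
    such that [omega v w <> 0] for some [v] in [V]: moving inside the coset by a
    multiple of [v] compensates the height, so that one horizontal segment joins
    two nearby cosets. Since [alpha >= 1] and the vertical axis has dimension 1,
    some [p] with [p.1 <> 0] satisfies [dim (A n B(p, r)) > alpha] for all [r].
    For almost every [V] some [v] in [V] has [omega v p.1 <> 0], and then (1)
    applied to [A n B(p, 1/k)], for [k] large depending on [V], gives (2).

    That [{V | omega = 0 on V x {z}}] is null for [z <> 0] follows from
    invariance: its measure [c] does not depend on [z], and a given [V] belongs
    to at most [2n] of these sets when [z] runs over the points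
    [(1, i, i^2, ...)] of the moment curve, so that [N c <= 2n] for all [N]. *)

(** * Sets of Hausdorff measure zero *)

Section hausdorff_null.
Context {R : realType} {T : Type}.
Implicit Types (d : T -> T -> \bar R) (A B : set T) (s : R).

(** Moves the guard on nonempty pieces from the index set of the series in [hausdorff_content] into
    its terms. *)
Definition piece_cost d s (C : set T) : \bar R :=
  if C != set0 then poweR (diam d C) s else 0%E.

(** The unfolded form of vanishing [s]-dimensional Hausdorff measure. The dimension is an infimum
    over such [s], so dimensions are compared below by transferring these covers. *)
Definition small_covers d s A := forall delta e : R, 0 < delta -> 0 < e ->
  exists C : (set T)^nat, [/\ A `<=` \bigcup_k C k,
    forall k, (diam d (C k) <= delta%:E)%E &
    (\sum_(0 <= k <oo) piece_cost d s (C k) < e%:E)%E].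

Lemma piece_cost_ge0 d s C : (0 <= piece_cost d s C)%E.
Proof. by rewrite /piece_cost; case: ifP => // _; exact: poweR_ge0. Qed.

Lemma sum_piece_cost d s (C : (set T)^nat) :
  (\sum_(0 <= k <oo) piece_cost d s (C k) =
   \sum_(0 <= k <oo | C k != set0) poweR (diam d (C k)) s)%E.
Proof. by rewrite [RHS]eseries_mkcond. Qed.

Lemma hausdorff_measure0P d s A :
  hausdorff_measure d s A = 0%E <-> small_covers d s A.
Proof.
have content_ge0 delta : (0 <= hausdorff_content d s delta A)%E.
  apply: le_ereal_inf_tmp => _ [C _ <-].
  by rewrite -sum_piece_cost; apply: nneseries_ge0 => k _ _; exact: piece_cost_ge0.
split=> [H0 delta e delta0 e0|cov].
  have c0 : (hausdorff_content d s delta A < e%:E)%E.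
    rewrite (@le_lt_trans _ _ 0%E)// -H0.
    by apply: ereal_sup_ubound; exists delta.
  have [_ [C [AC dC] <-] sC] := ereal_inf_lt c0.
  by exists C; split; rewrite ?sum_piece_cost.
apply/eqP; rewrite eq_le; apply/andP; split; last first.
  apply: le_trans (content_ge0 1) _; apply: ereal_sup_ubound.
  by exists 1 => //=.
apply: ge_ereal_sup => _ [delta delta0 <-].
apply/lee_addgt0Pr => e e0; rewrite add0e.
have [C [AC dC sC]] := cov delta e delta0 e0.
apply: le_trans (ltW sC); apply: ereal_inf_lbound.
by exists C; rewrite ?sum_piece_cost.
Qed.

Lemma small_covers_subset d s A B : A `<=` B ->
  small_covers d s B -> small_covers d s A.
Proof.
move=> AB cB delta e d0 e0; have [C [BC dC sC]] := cB _ _ d0 e0.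
by exists C; split => //; exact: subset_trans AB BC.
Qed.

Lemma small_covers_bigcup d s (A : (set T)^nat) :
  (forall k, small_covers d s (A k)) -> small_covers d s (\bigcup_k A k).
Proof.
move=> cA delta e d0 e0.
(* The budgets add up to [e / 2] rather than [e]: summation preserves only weak inequalities, and a
   strict bound is required. *)
have e2k k : 0 < (e / 2) / (2 ^ k.+1)%:R :> R.
  by rewrite !divr_gt0// ltr0n expn_gt0.
have /choice[C hC] k := cA k _ _ d0 (e2k k).
(* A bijection of the naturals with pairs enumerates the double family of pieces. *)
have /card_esym/ppcard_eqP[f] := card_nat2.
exists (fun n => C (f n).1 (f n).2); split.
- move=> x [k _ Akx]; have [Ck _ _] := hC k.
  have [j _ Cj] := Ck _ Akx.
  have [n _ fn] : [set (f x) | x in setT] (k, j) by exact: 'surj_f.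
  by exists n => //; rewrite fn.
- by move=> n; have [_ + _] := hC (f n).1; exact.
- rewrite nneseries_esumT; last by move=> n; exact: piece_cost_ge0.
  rewrite -(@reindex_esum R _ _ setT setT f
    (fun ij => piece_cost d s (C ij.1 ij.2))); last exact: 'bij_f.
  rewrite (_ : [set: nat * nat] = setT `*`` (fun=> setT)); last first.
    by apply/seteqP; split.
  rewrite -(@esum_esum R _ _ setT (fun=> setT)
    (fun i j => piece_cost d s (C i j))); last first.
    by move=> *; exact: piece_cost_ge0.
  apply: (@le_lt_trans _ _ (e / 2)%:E); last first.
    by rewrite lte_fin ltr_pdivrMr// ltr_pMr// ltr1n.
  rewrite -[leRHS]add0e.
  rewrite -nneseries_esumT; last first.
    by move=> i; apply: esum_ge0 => *; exact: piece_cost_ge0.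
  have e20 : 0 <= e / 2 by rewrite divr_ge0// ltW.
  have h := @epsilon_trick R (fun=> 0%E) (e / 2) xpredT (fun=> lexx _) e20.
  have z : (\sum_(0 <= i <oo) (0 : \bar R) = 0)%E by rewrite eseries0.
  rewrite z in h; apply: le_trans h; apply: lee_nneseries => [k _ _|k _].
    by apply: esum_ge0 => *; exact: piece_cost_ge0.
  rewrite add0e -nneseries_esumT; last by move=> i; exact: piece_cost_ge0.
  by have [_ _ /ltW] := hC k.
Qed.


Lemma diam_ge0 d (C : set T) : (forall x y, 0 <= d x y)%E -> C !=set0 ->
  (0 <= diam d C)%E.
Proof.
move=> d0 [x Cx]; apply: le_trans (d0 x x) _; apply: ereal_sup_ubound.
by exists (x, x).
Qed.

(** Once all diameters are at most 1, raising the exponent does not increase the cost of a piece. *)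
Lemma small_covers_le d s s' A : (forall x y, 0 <= d x y)%E ->
  0 <= s -> s <= s' -> small_covers d s A -> small_covers d s' A.
Proof.
move=> dge0 s0 ss' cA delta e d0 e0.
have [|C [AC dC sC]] := cA (Num.min delta 1) e _ e0; first by rewrite lt_min d0/=.
exists C; split => //.
  by move=> k; rewrite (le_trans (dC k))// lee_fin ge_min lexx.
apply: le_lt_trans sC; apply: lee_nneseries => [k _ _|k _].
  exact: piece_cost_ge0.
rewrite /piece_cost; case: ifPn => // /set0P Ck0.
have := diam_ge0 dge0 Ck0.
have : (diam d (C k) <= 1%:E)%E by rewrite (le_trans (dC k))// lee_fin ge_min lexx orbT.
case: (diam d (C k)) => [x| |]//; rewrite !lee_fin => x1 x0.
have [x00|x00] := eqVneq x 0; last by rewrite ger_powR// lt_neqAle eq_sym x00 x0.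
(* Diameter 0 is treated apart because zero to the power zero is 1: if [s' != s] then [s'] is
   positive, and the new cost is 0. *)
rewrite x00; have [->|s'0] := eqVneq s' s; first by [].
have s'00 : s' != 0.
  by apply: contraNneq s'0 => s'00; rewrite eq_sym eq_le ss' s'00 s0.
by rewrite powR0// powR_ge0.
Qed.


(** The pieces are cut down to [A], where the Lipschitz bound holds. Diameters then grow by the
    factor [L] and costs by its [s]-th power, so scale and budget are divided by these in
    advance. *)
Lemma small_covers_lipschitz d d' s (L : R) A :
  (forall x y, 0 <= d x y)%E -> (forall x y, 0 <= d' x y)%E -> 0 <= s -> 0 < L ->
  (forall x y, A x -> A y -> (d x y <= L%:E * d' x y)%E) ->
  small_covers d' s A -> small_covers d s A.
Proof.
move=> dge0 d'ge0 s0 L0 dLd' cA delta e d0 e0.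
have Ls0 : 0 < L `^ s by rewrite powR_gt0.
have dL0 : 0 < delta / L by rewrite divr_gt0.
have eL0 : 0 < e / L `^ s by rewrite divr_gt0.
have [C [AC dC sC]] := cA _ _ dL0 eL0.
have diamC k : C k `&` A !=set0 ->
    (diam d (C k `&` A) <= L%:E * diam d' (C k))%E.
  move=> _; apply: ge_ereal_sup => _ [[x y] [/= [Cx Ax] [Cy Ay]] <-].
  apply: le_trans (dLd' _ _ Ax Ay) _; rewrite lee_pmul2l//.
  by apply: ereal_sup_ubound; exists (x, y).
exists (fun k => C k `&` A); split.
- by move=> x Ax; have [k _ Ck] := AC x Ax; exists k.
- move=> k; have [->|/set0P CA] := eqVneq (C k `&` A) set0.
    rewrite /diam (_ : [set _ | _ in _] = set0) ?ereal_sup0 ?leNye//.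
    by apply/seteqP; split => // y [xy [[]]].
  apply: le_trans (diamC k CA) _.
  rewrite -[in leRHS](divfK (lt0r_neq0 L0) delta) mulrC.
  by rewrite EFinM; rewrite lee_pmul2l//.
- apply: (@le_lt_trans _ _ ((L `^ s)%:E * \sum_(0 <= k <oo) piece_cost d' s (C k))%E);
    last first.
    rewrite -[in ltRHS](divfK (lt0r_neq0 Ls0) e) mulrC.
    by rewrite EFinM lte_pmul2l.
  rewrite -nneseriesZl//; last first.
    by move=> k _; exact: piece_cost_ge0.
  apply: lee_nneseries => [k _ _|k _]; first exact: piece_cost_ge0.
  rewrite /piece_cost; case: ifPn => [/set0P CA|_]; last first.
    by apply: mule_ge0; [rewrite lee_fin powR_ge0|exact: piece_cost_ge0].
  have Ck0 : C k !=set0 by case: CA => x [Cx _]; exists x.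
  rewrite ifT; last exact/set0P.
  rewrite -poweR_EFin -poweRM//; last exact: diam_ge0.
    apply: gt0_ler_poweR => //; last exact: diamC.
      by rewrite in_itv/= leey andbT; exact: diam_ge0.
    rewrite in_itv/= leey andbT mule_ge0//; last exact: diam_ge0.
    by rewrite lee_fin ltW.
  by rewrite lee_fin ltW.
Qed.

Lemma hausdorff_dim_le d d' A B :
  (forall s, 0 <= s -> small_covers d s A -> small_covers d' s B) ->
  (hausdorff_dim d' B <= hausdorff_dim d A)%E.
Proof.
move=> h; apply: le_ereal_inf => _ [s [s0 /hausdorff_measure0P cA] <-].
by exists s => //; split => //; apply/hausdorff_measure0P/h.
Qed.

Lemma hausdorff_dim_subset d A B : A `<=` B ->
  (hausdorff_dim d A <= hausdorff_dim d B)%E.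
Proof. by move=> AB; apply: hausdorff_dim_le => s _; exact: small_covers_subset. Qed.

Lemma hausdorff_dim_le_covers d A s : 0 <= s -> small_covers d s A ->
  (hausdorff_dim d A <= s%:E)%E.
Proof.
move=> s0 cA; apply: ereal_inf_lbound; exists s => //.
by split => //; apply/hausdorff_measure0P.
Qed.

(** The exponents of measure zero are closed upwards, so any number above their infimum is one of
    them. *)
Lemma hausdorff_dim_lt_covers d A s : (forall x y, 0 <= d x y)%E ->
  (hausdorff_dim d A < s%:E)%E -> small_covers d s A.
Proof.
move=> d0 /ereal_inf_lt[_ [r [r0 /hausdorff_measure0P cA] <-]].
by rewrite lte_fin => /ltW rs; exact: small_covers_le cA.
Qed.

End hausdorff_null.

(** * Countable unions of null sets *)

Section countable_union.
Context {R : realType} {T : Type}.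
Variables (d : T -> T -> \bar R) (s : R).

Lemma small_covers0 : small_covers d s set0.
Proof.
move=> delta e delta0 e0; exists (fun=> set0); split => //.
  move=> k; rewrite /diam (_ : [set _ | _ in _] = set0) ?ereal_sup0 ?leNye//.
  by apply/seteqP; split => // y [xy [[]]].
by rewrite eseries0 ?lte_fin// => k _ _; rewrite /piece_cost eqxx.
Qed.

Lemma small_covers_countable (I : countType) (A : I -> set T) :
  (forall i, small_covers d s (A i)) -> small_covers d s (\bigcup_i A i).
Proof.
move=> cA; pose B k := if unpickle k is Some i then A i else set0.
apply: (@small_covers_subset _ _ _ _ _ (\bigcup_k B k)).
  by move=> x [i _ Aix]; exists (pickle i); rewrite // /B pickleK.
apply: small_covers_bigcup => k; rewrite /B.
by case: unpickle => [i|]; [exact: cA|exact: small_covers0].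
Qed.

Lemma small_coversU (A B : set T) :
  small_covers d s A -> small_covers d s B -> small_covers d s (A `|` B).
Proof.
move=> cA cB; rewrite (_ : A `|` B = \bigcup_(b in [set: bool]) if b then A else B).
  by apply: small_covers_countable => -[].
apply/seteqP; split => [x [Ax|Bx]|x [[] _]].
- by exists true.
- by exists false.
- by left.
- by right.
Qed.

End countable_union.

(** * The Euclidean norm on row vectors *)

Section euclidean_norm.
Context {R : realType} {k : nat}.
Implicit Types u v : 'rV[R]_k.

Definition l2 u := Num.sqrt (dot u u).

Lemma dot_ge0 u : 0 <= dot u u.
Proof. by apply: sumr_ge0 => i _; rewrite -expr2 sqr_ge0. Qed.

Lemma l2_ge0 u : 0 <= l2 u. Proof. exact: sqrtr_ge0. Qed.

Lemma sqr_l2 u : l2 u ^+ 2 = dot u u.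
Proof. by rewrite sqr_sqrtr// dot_ge0. Qed.

Lemma l2N u : l2 (- u) = l2 u.
Proof.
by congr Num.sqrt; apply: eq_bigr => i _; rewrite !mxE mulrNN.
Qed.

Lemma coord_le_l2 u i : `|u 0 i| <= l2 u.
Proof.
rewrite -sqrtr_sqr ler_wsqrtr// /dot (bigD1 i)//= -expr2 lerDl.
by apply: sumr_ge0 => j _; rewrite -expr2 sqr_ge0.
Qed.

Lemma l2_le_coord u (c : R) : (forall i, `|u 0 i| <= c) -> l2 u <= k%:R * c.
Proof.
move=> uc; have [k0|k0] := posnP k.
  have nok (j : 'I_k) : False by have := ltn_ord j; rewrite [X in (_ < X)%N]k0.
  by rewrite /l2 /dot big1 ?sqrtr0 ?[in leRHS]k0 ?mul0r// => j; case: (nok j).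
have c0 : 0 <= c by apply: le_trans (uc (Ordinal k0)); rewrite normr_ge0.
rewrite -(@ler_pXn2r _ 2)// ?nnegrE ?l2_ge0 ?mulr_ge0// sqr_l2 exprMn.
apply: (@le_trans _ _ (k%:R * c ^+ 2)).
  rewrite /dot mulr_natl -[in leRHS](card_ord k) -sumr_const; apply: ler_sum => i _.
  by rewrite -expr2 -real_normK ?num_real// ler_pXn2r// nnegrE.
rewrite ler_wpM2r ?sqr_ge0// expr2 ler_peMl// ler1n.
exact: k0.
Qed.

Lemma dot_eq0 u : dot u u = 0 -> u = 0.
Proof.
move=> u0; apply/rowP => i; rewrite mxE; apply/eqP.
have : l2 u = 0 by rewrite /l2 u0 sqrtr0.
by move=> h; have := coord_le_l2 u i; rewrite h normr_le0.
Qed.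

End euclidean_norm.

(** * Euclidean distance and the symplectic form *)

Section heisenberg_basics.
Context {R : realType} {n : nat}.
Local Notation vec := 'rV[R]_(n + n).
Local Notation H := (heis R n).
Implicit Types (z w : vec) (p q : H) (V : {vspace vec}).

Definition ed p q : R :=
  Num.sqrt (dot (p.1 - q.1) (p.1 - q.1) + (p.2 - q.2) ^+ 2).

Lemma eucl_distE p q : eucl_dist p q = (ed p q)%:E. Proof. by []. Qed.

Lemma eucl_dist_ge0 p q : (0 <= eucl_dist p q)%E.
Proof. by rewrite lee_fin sqrtr_ge0. Qed.

Lemma l2_le_ed p q : l2 (p.1 - q.1) <= ed p q.
Proof. by rewrite ler_wsqrtr// lerDl sqr_ge0. Qed.

Lemma abs_le_ed p q : `|p.2 - q.2| <= ed p q.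
Proof. by rewrite -sqrtr_sqr ler_wsqrtr// lerDr dot_ge0. Qed.

Lemma ed_le p q : ed p q <= l2 (p.1 - q.1) + `|p.2 - q.2|.
Proof.
have ed2 : ed p q ^+ 2 = l2 (p.1 - q.1) ^+ 2 + `|p.2 - q.2| ^+ 2.
  by rewrite sqr_sqrtr ?addr_ge0 ?dot_ge0 ?sqr_ge0// sqr_l2 real_normK ?num_real.
rewrite -(@ler_pXn2r _ 2)// ?nnegrE ?sqrtr_ge0 ?addr_ge0 ?l2_ge0// ed2.
have := mulr_ge0 (l2_ge0 (p.1 - q.1)) (normr_ge0 (p.2 - q.2)); nra.
Qed.

Lemma omegaDl z z' w : omega (z + z') w = omega z w + omega z' w.
Proof. by rewrite /omega -big_split; apply: eq_bigr => j _ /=; rewrite !mxE; ring. Qed.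

Lemma omegaDr z w w' : omega z (w + w') = omega z w + omega z w'.
Proof. by rewrite /omega -big_split; apply: eq_bigr => j _ /=; rewrite !mxE; ring. Qed.

Lemma omegaZl (c : R) z w : omega (c *: z) w = c * omega z w.
Proof. by rewrite /omega mulr_sumr; apply: eq_bigr => j _; rewrite !mxE; ring. Qed.

Lemma omegaZr (c : R) z w : omega z (c *: w) = c * omega z w.
Proof. by rewrite /omega mulr_sumr; apply: eq_bigr => j _; rewrite !mxE; ring. Qed.

Lemma omegaNl z w : omega (- z) w = - omega z w.
Proof. by rewrite -scaleN1r omegaZl mulN1r. Qed.

Lemma omegaNr z w : omega z (- w) = - omega z w.
Proof. by rewrite -scaleN1r omegaZr mulN1r. Qed.

Lemma omegaC z w : omega z w = - omega w z.
Proof. by rewrite /omega -sumrN; apply: eq_bigr => j _; ring. Qed.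

Lemma omegazz z : omega z z = 0.
Proof. by rewrite /omega big1// => j _; ring. Qed.

Lemma omega_le_coord z w (c d : R) : (forall i, `|z 0 i| <= c) ->
  (forall i, `|w 0 i| <= d) -> `|omega z w| <= (2 * n)%:R * (c * d).
Proof.
move=> zc wd; apply: le_trans (ler_norm_sum _ _ _) _.
rewrite natrM (mulrC 2%:R) -mulrA mulr_natl -[in leRHS](card_ord n) -sumr_const.
apply: ler_sum => j _; apply: le_trans (ler_normB _ _) _.
have h i i' : `|z 0 i * w 0 i'| <= c * d by rewrite normrM ler_pM.
rewrite !mxE; have := h (lshift n j) (rshift n j).
by have := h (rshift n j) (lshift n j); lra.
Qed.

Lemma omega_le z w : `|omega z w| <= (2 * n)%:R * (l2 z * l2 w).
Proof. by apply: omega_le_coord => i; exact: coord_le_l2. Qed.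

End heisenberg_basics.

(** * Points of concentration *)

Section localisation.
Context {R : realType} {n : nat}.
Local Notation H := (heis R n).
Implicit Types (p q : H) (A : set H) (s : R).

Lemma exists_small_powR (r e : R) : 0 < r -> 0 < e ->
  exists2 N : nat, (0 < N)%N & (N%:R^-1 : R) `^ r < e.
Proof.
move=> r0 e0.
have t0 : 0 < e `^ r^-1 by rewrite powR_gt0.
exists (Num.bound (e `^ r^-1)^-1).+1 => //.
set N := _.+1.
have N0 : 0 < N%:R :> R by rewrite ltr0n.
have Nt : N%:R^-1 < e `^ r^-1.
  rewrite invf_plt ?posrE//; apply: (@lt_trans _ _ (Num.bound (e `^ r^-1)^-1)%:R).
    by apply: le_lt_trans (archi_boundP _); rewrite ?ler_norm// invr_ge0 ltW.
  by rewrite ltr_nat.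
have := @gt0_ltr_powR R r r0 (N%:R^-1) (e `^ r^-1).
rewrite -powRrM mulVf ?gt_eqF// powRr1 ?ltW//; apply => //.
  by rewrite nnegrE invr_ge0 ltW.
by rewrite nnegrE ltW.
Qed.

(** A vertical segment of length 1 splits into [N] pieces of diameter at most [N^-1], of total cost
    at most [N] to the power [1 - s], which tends to 0. The axis is a countable union of such
    segments. *)
Lemma t_axis_covers s : 1 < s ->
  small_covers (@eucl_dist R n) s [set p : H | p.1 = 0].
Proof.
move=> s1.
pose I (k : int) := [set p : H | p.1 = 0 /\ k%:~R <= p.2 <= k%:~R + 1].
apply: (@small_covers_subset _ _ _ _ _ (\bigcup_k I k)).
  move=> p p0; exists (Num.floor p.2) => //; split => //.
  by rewrite ge_floor/= ltW// -intrD1 floorD1_gt.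
apply: small_covers_countable => k delta e d0 e0.
have sm0 : 0 < s - 1 by rewrite subr_gt0.
have [N1 N10 hN1] := exists_small_powR sm0 e0.
have [N2 N20 hN2] := exists_small_powR (@ltr01 R) d0.
(* [N1] makes the total cost smaller than [e], [N2] makes the mesh smaller than [delta]; the sum
   does both. *)
pose N := (N1 + N2)%N.
have N0 : 0 < N%:R :> R by rewrite ltr0n addn_gt0 N10.
have N1r : 0 < N1%:R :> R by rewrite ltr0n.
have N2r : 0 < N2%:R :> R by rewrite ltr0n.
have hN : (N%:R^-1 : R) `^ (s - 1) < e.
  apply: le_lt_trans hN1.
  rewrite ge0_ler_powR ?nnegrE ?invr_ge0 ?ler0n//; first exact: ltW.
  by rewrite lef_pV2 ?posrE// ler_nat leq_addr.
have hN' : N%:R^-1 <= delta.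
  apply: le_trans (ltW hN2); rewrite powRr1 ?invr_ge0//.
  by rewrite lef_pV2 ?posrE// ler_nat leq_addl.
pose C (i : nat) := if (i < N)%N then [set p : H | p.1 = 0 /\
  k%:~R + i%:R / N%:R <= p.2 <= k%:~R + i.+1%:R / N%:R] else set0.
have diamC i : (diam (@eucl_dist R n) (C i) <= (N%:R^-1)%:E)%E.
  apply: ge_ereal_sup => _ [[p q] /= [Cp Cq] <-]; rewrite lee_fin.
  move: Cp Cq; rewrite /C; case: ifP => // _ [p0 /andP[p1 p2]] [q0 /andP[q1 q2]].
  apply: le_trans (ed_le _ _) _; rewrite p0 q0 subrr.
  rewrite /l2 /dot big1 ?sqrtr0 ?add0r; last by move=> j _; rewrite mxE mul0r.
  move: p2 q2; rewrite -natr1 mulrDl mul1r => p2 q2.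
  by rewrite ler_norml; apply/andP; split; lra.
exists C; split.
- move=> p [p0 /andP[pk pk1]]; pose x := (p.2 - k%:~R) * N%:R.
  have x0 : 0 <= x by rewrite mulr_ge0 ?subr_ge0// (ltW N0).
  have xN : x <= N%:R by rewrite ler_piMl ?(ltW N0)//; lra.
  have pE : p.2 = k%:~R + x / N%:R by rewrite /x mulfK ?gt_eqF// addrC subrK.
  (* The upper endpoint goes to the last piece [N.-1]: truncating [x] there would give the index
     [N], whose piece is empty. *)
  have [eN|neN] := eqVneq x N%:R.
    exists N.-1 => //; rewrite /C prednK ?ltr0n -?(ltr_nat R)// leqnn; split => //.
    rewrite pE !lerD2l eN lexx andbT ler_pM2r ?invr_gt0// ler_nat.
    exact: leq_pred.
  have xN' : x < N%:R by rewrite lt_neqAle neN xN.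
  exists (Num.truncn x) => //; have /andP[t1 t2] := truncn_itv x0.
  rewrite /C ifT; last by rewrite -(ltr_nat R) (le_lt_trans t1).
  by split => //; rewrite pE !lerD2l !ler_pM2r ?invr_gt0// t1 ltW.
- by move=> i; apply: le_trans (diamC i) _; rewrite lee_fin.
- rewrite (nneseries_split _ N); last by move=> i _; exact: piece_cost_ge0.
  rewrite [X in (_ + X)%E]eseries0 ?adde0; last first.
    move=> i; rewrite add0n => Ni _; rewrite /C ltnNge Ni/=.
    by rewrite /piece_cost eqxx.
  rewrite add0n; apply: (@le_lt_trans _ _ (\sum_(0 <= i < N) ((N%:R^-1 : R) `^ s)%:E)%E).
    apply: lee_sum => i _; rewrite /piece_cost; case: ifPn => [/set0P C0|_].
      rewrite -poweR_EFin; apply: gt0_ler_poweR; rewrite ?in_itv/= ?leey ?andbT//.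
      + by rewrite ltW// (lt_trans ltr01).
      + by apply: diam_ge0 => //; exact: eucl_dist_ge0.
    by rewrite lee_fin powR_ge0.
  rewrite sumEFin lte_fin big_mkord sumr_const card_ord.
  have Ni0 : N%:R^-1 != 0 :> R by rewrite invr_neq0 ?gt_eqF.
  apply: le_lt_trans hN; rewrite powRB ?Ni0 ?implybT//.
  by rewrite powRr1 ?invr_ge0 ?(ltW N0)// invrK mulr_natr.
Qed.

(** Half-open cubes of side [i.1.+1%:R^-1] on the corresponding grid. Their index type is countable,
    so they serve as a countable base. *)
Definition cell (i : nat * ('rV[int]_(n + n) * int)) : set H :=
  [set p : H | (forall j, Num.floor (i.1.+1%:R * p.1 0 j) = i.2.1 0 j) /\
               Num.floor (i.1.+1%:R * p.2) = i.2.2].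

Lemma floor_eq_dist (N x y : R) : 0 < N ->
  Num.floor (N * x) = Num.floor (N * y) -> `|x - y| < N^-1.
Proof.
move=> N0 e.
have /andP[x1 x2] := floor_itv (N * x); have /andP[y1 y2] := floor_itv (N * y).
rewrite intrD in x2; rewrite intrD in y2; rewrite e in x1 x2.
have -> : `|x - y| = N^-1 * `|N * x - N * y|.
  by rewrite -mulrBr normrM gtr0_norm// mulrA mulVf ?mul1r// gt_eqF.
rewrite gtr_pMr ?invr_gt0// ltr_norml; apply/andP; split; lra.
Qed.

Lemma exists_cell_sub_ball p (r : R) : 0 < r ->
  exists i, cell i p /\ cell i `<=` ball p r.
Proof.
move=> r0; have [N N0 hN] := exists_small_powR (@ltr01 R) r0.
rewrite powRr1 ?invr_ge0// in hN.
have NE : N.-1.+1%:R = N%:R :> R by rewrite prednK.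
pose c := (\row_j Num.floor (N%:R * p.1 0 j), Num.floor (N%:R * p.2)).
have N0r : 0 < N%:R :> R by rewrite ltr0n.
exists (N.-1, c); split; first by split => [j|]; rewrite /= NE ?mxE.
move=> q [q1 q2]; rewrite /= NE in q2; split => /=.
  split => // i j; rewrite !ord1 /ball/= (lt_trans _ hN)//.
  by apply: floor_eq_dist => //; have := q1 j; rewrite /= NE mxE.
by rewrite /ball/= (lt_trans _ hN)//; apply: floor_eq_dist.
Qed.

(** A Lindelöf argument. Otherwise each point of [A] off the vertical axis lies in a cell whose
    trace on [A] is [s]-null, for a fixed [s] above [alpha]. There are countably many cells and the
    axis is [s]-null because [1 < s], so [A] would be [s]-null. *)
Lemma exists_concentration_point A (alpha : R) : 1 <= alpha ->
  (alpha%:E < hausdorff_dim eucl_dist A)%E ->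
  exists p, p.1 != 0 /\ forall r : R, 0 < r ->
    (alpha%:E < hausdorff_dim eucl_dist (A `&` ball p r))%E.
Proof.
move=> alpha1 dimA; apply: contrapT => noP.
(* Dimension at most [alpha] gives null measure only for exponents strictly above [alpha], hence the
   intermediate [s]. The dimension of [A] is allowed to be infinite here. *)
have [s [als sdim]] : exists s : R, alpha < s /\ (s%:E < hausdorff_dim eucl_dist A)%E.
  move: dimA; case: (hausdorff_dim _ A) => [x| |]//.
    rewrite lte_fin => ax; exists ((alpha + x) / 2).
    by rewrite lte_fin; split; lra.
  by move=> _; exists (alpha + 1); rewrite ltry; split=> //; lra.
suff : small_covers eucl_dist s A.
  have s0 : 0 <= s by lra.
  by move=> /(hausdorff_dim_le_covers s0); rewrite leNgt sdim.
pose B i := if `[< small_covers eucl_dist s (A `&` cell i) >] then A `&` cell i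
            else set0.
have cB : small_covers eucl_dist s (\bigcup_i B i).
  apply: small_covers_countable => i; rewrite /B; case: asboolP => // _.
  exact: small_covers0.
have s1 : 1 < s by apply: le_lt_trans als.
apply: small_covers_subset (small_coversU (t_axis_covers s1) cB).
move=> p Ap; have [p0|p0] := eqVneq p.1 0; [by left|right].
have [r [r0 hr]] : exists r : R, 0 < r /\
    (hausdorff_dim eucl_dist (A `&` ball p r) <= alpha%:E)%E.
  apply: contrapT => nor; apply: noP; exists p; split => // r r0.
  by rewrite ltNge; apply/negP => h; apply: nor; exists r.
have [i [pi ir]] := exists_cell_sub_ball p r0.
exists i => //; rewrite /B; case: asboolP => // -[].
apply: (@small_covers_subset _ _ _ _ _ (A `&` ball p r)); first exact: setIS.
apply: hausdorff_dim_lt_covers; first exact: eucl_dist_ge0.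
exact: le_lt_trans hr _.
Qed.

End localisation.

(** * Absolutely continuous functions *)

Section real_line.
Context {R : realType}.
Local Notation leb := (@lebesgue_measure R).

(** Continuous induction: the supremum of the [x] with [Q a x] is again such a point by the local
    hypothesis and transitivity, and the same argument pushes beyond it if it is below [b]. *)
Lemma interval_induction (Q : R -> R -> Prop) (a b : R) : a <= b ->
  (forall u v w, a <= u -> u <= v -> v <= w -> w <= b ->
     Q u v -> Q v w -> Q u w) ->
  (forall x, a <= x <= b -> exists2 r, 0 < r &
     forall u v, a <= u -> u <= x -> x <= v -> v <= b ->
       x - r < u -> v < x + r -> Q u v) ->
  Q a b.
Proof.
move=> ab Qtrans Qloc.
pose S := [set x | a <= x <= b /\ Q a x].
have Sa : S a.
  split; first by rewrite lexx.
  have [|r r0 h] := Qloc a; first by rewrite lexx.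
  by apply: h => //; [rewrite ltrBlDr ltrDl|rewrite ltrDl].
have Sub : ubound S b by move=> x [/andP[]].
have hS : has_sup S by split; [exists a|exists b].
set c := sup S.
have ac : a <= c by apply: sup_upper_bound.
have cb : c <= b by apply: ge_sup => //; exists a.
have [|r r0 h] := Qloc c; first by rewrite ac.
have [y [/andP[ay yb] Qay] cry] := sup_adherent r0 hS.
have yc : y <= c by apply: sup_upper_bound => //; split => //; apply/andP.
have Qac : Q a c.
  apply: (Qtrans a y c) => //.
  by apply: h => //; rewrite ltrDl.
have [cltb|bc] := ltP c b; last first.
  by have -> : b = c by apply/eqP; rewrite eq_le bc.
pose z := Num.min b (c + r / 2).
have cz : c < z by rewrite /z lt_min cltb ltrDl divr_gt0.
have zb : z <= b by rewrite /z ge_min lexx.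
have Sz : S z.
  split; first by rewrite (le_trans ac (ltW cz)).
  apply: (Qtrans a c z) => //; first exact: ltW.
  apply: h => //; first exact: ltW.
    by rewrite ltrBlDr ltrDl.
  rewrite /z gt_min; apply/orP; right.
  by rewrite ltrD2l ltr_pdivrMr// ltr_pMr// ltr1n.
by have := sup_upper_bound hS Sz; rewrite leNgt cz.
Qed.

(** As [[u, v]] straddles [s], the errors of the two difference quotients at [s] add up to at most
    [e * (v - u)]. The terms in [l] have the favourable sign. *)
Lemma derive_ge0_local (G : R -> R) (s l e : R) : is_derive s 1 G l ->
  0 <= l -> 0 < e -> exists2 r, 0 < r &
  forall u v, u <= s -> s <= v -> s - r < u -> v < s + r ->
    - (e * (v - u)) <= G v - G u.
Proof.
move=> dG l0 e0.
have [dv Dl] := dG.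
have : (fun h => h^-1 *: (G (h + s) - G s)) @ 0^' --> l.
  have := dv; rewrite /derivable => /cvg_ex[l' hl'].
  have -> : (fun h => h^-1 *: (G (h + s) - G s)) =
            (fun h => h^-1 *: ((G \o shift s) (h *: 1) - G s)).
    by apply/funext => h; rewrite /= [h *: 1]mulr1.
  have <- : l' = l by rewrite -Dl; apply/esym/cvg_lim.
  exact: hl'.
move=> /cvgrPdist_lt/(_ _ e0)/= [r /= r0 hr].
have key h : `|h| < r -> h != 0 -> `|G (h + s) - G s - h * l| <= e * `|h|.
  move=> hr' h0.
  have := hr h; rewrite /= sub0r normrN => /(_ hr' h0).
  rewrite distrC => H.
  have -> : G (h + s) - G s - h * l = h * (h^-1 *: (G (h + s) - G s) - l).
    by rewrite mulrBr /GRing.scale/= mulrA divff// mul1r.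
  by rewrite normrM mulrC ler_wpM2r// ltW.
exists r => // u v us sv sru vsr.
have hv : - (e * (v - s)) <= G v - G s.
  have [->|vs] := eqVneq v s; first by rewrite !subrr mulr0 oppr0.
  have v0 : 0 < v - s by rewrite subr_gt0 lt_neqAle eq_sym vs.
  have := key (v - s); rewrite subrK gt_eqF// gtr0_norm// => /(_ _ isT).
  rewrite ltrBlDl => /(_ vsr); rewrite ler_norml => /andP[H _].
  have := mulr_ge0 (ltW v0) l0; lra.
have hu : - (e * (s - u)) <= G s - G u.
  have [->|vs] := eqVneq u s; first by rewrite !subrr mulr0 oppr0.
  have v0 : u - s < 0 by rewrite subr_lt0 lt_neqAle vs.
  have := key (u - s); rewrite subrK lt_eqF// ltr0_norm// opprB => /(_ _ isT).
  rewrite ltrBlDl -ltrBlDr => /(_ sru); rewrite ler_norml => /andP[_ H].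
  have := mulr_ge0_le0 l0 (ltW v0); lra.
lra.
Qed.

(** Outer regularity applied to a measurable null set [N] containing the exceptional points; it
    bounds the measure of [U] outside [N], which is that of [U]. *)
Lemma ae_not_null (P : R -> Prop) : {ae leb, forall s, P s} ->
  forall e : R, 0 < e -> exists U : set R,
    [/\ open U, (forall s, ~ P s -> U s) & (leb U < e%:E)%E].
Proof.
move=> [N [mN N0 PN]] e e0.
have [|U [oU NU muU]] := @lebesgue_regularity_outer R N e mN _ e0.
  by rewrite [X in (X < _)%E]N0.
exists U; split => //; first by move=> s nPs; apply/NU/PN.
have mU := open_measurable oU.
rewrite (le_lt_trans _ muU)//.
rewrite -[leRHS]adde0 -[in leRHS]N0.
apply: le_trans (measureU2 _ _ _) => //; last exact: measurableD.
apply: le_measure; rewrite ?inE//; first by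
  apply: measurableU => //; exact: measurableD.
by move=> x Ux; have [|] := pselect (N x); [right|left].
Qed.

(* The exceptional null set lies in an open set [U] of small measure. Chaining
   over a fine partition, the increments of [f] are controlled by those of [F]
   outside [U]; inside [U] they are recorded in a list of disjoint intervals,
   whose contribution is small by absolute continuity. *)
Lemma ac_le_of_derive_le (f F : R -> R) (b : R) : 0 <= b -> b <= 1 ->
  absolutely_continuous 0 1 f ->
  {homo F : x y / x <= y} ->
  {ae leb, forall s : R, s \in `[0, 1]%R ->
     exists l l' : R, [/\ is_derive s 1 F l, is_derive s 1 f l' & l' <= l]} ->
  f b - f 0 <= F b - F 0.
Proof.
move=> b0 b1 acf ndF aeP.
apply/ler_addgt0Pl => e e0.
have e20 : 0 < e / 2 by rewrite divr_gt0.
have [d d0 acd] := acf _ e20.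
have [U [oU NU muU]] := ae_not_null aeP d0.
have mU := open_measurable oU.
(* The measure of [U] swept up to [x]: an additive quantity, below [d], to which the lengths of the
   recorded intervals are charged. *)
pose M x := fine (leb (U `&` `]0, x])).
have muUI x : leb (U `&` `]0, x]) \is a fin_num.
  rewrite ge0_fin_numE// (le_lt_trans _ (lt_trans muU (ltry _)))//.
  by apply: le_measure; rewrite ?inE//; exact: measurableI.
have MD u v : 0 <= u -> u <= v -> (M v)%:E = ((M u)%:E + leb (U `&` `]u, v]))%E.
  move=> u0 uv; rewrite /M !fineK//.
  rewrite -measureU; first last.
  - rewrite setIACA setIid; apply/seteqP; split => // x [_ []] /=.
    by rewrite !in_itv/= => /andP[_ xu] /andP[+ _]; rewrite ltNge xu.
  - exact: measurableI.
  - exact: measurableI.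
  congr (leb _); rewrite -setIUr; congr (_ `&` _).
  by rewrite -itv_bndbnd_setU// bnd_simp.
have Mle u v : 0 <= u -> u <= v -> M u <= M v.
  move=> u0 uv; rewrite -lee_fin (MD u v)//.
  by rewrite leeDl.
pose Q u v := exists s : seq (R * R),
  [/\ all (fun p => [&& u <= p.1, p.1 <= p.2 & p.2 <= v]) s,
      pairwise (fun p q => p.2 <= q.1) s,
      \sum_(p <- s) (p.2 - p.1) <= M v - M u &
      f v - f u <= F v - F u + e / 2 * (v - u)
                    + \sum_(p <- s) `|f p.2 - f p.1| ].
have Q0b : Q 0 b.
  apply: interval_induction => //.
  - move=> u v w u0 uv vw wb [s [s1 s2 s3 s4]] [t [t1 t2 t3 t4]].
    exists (s ++ t); split.
    + rewrite all_cat; apply/andP; split.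
        apply: sub_all s1 => p /and3P[-> -> /=] /le_trans; exact.
      by apply: sub_all t1 => p /and3P[+ -> ->]; rewrite !andbT => /(le_trans uv).
    + rewrite pairwise_cat s2 t2 !andbT.
      apply/allrelP => p q /(allP s1) /and3P[_ _ pv] /(allP t1) /and3P[vq _ _].
      exact: le_trans pv vq.
    + by rewrite big_cat/=; lra.
    + by rewrite big_cat/=; lra.
  - move=> x /andP[x0 xb].
    (* Near a point of [U] the whole interval is recorded. Near any other point [F - f] has a
       nonnegative derivative, its loss is at most [e / 2 * (v - u)], and nothing is recorded. *)
    have [Ux|nUx] := pselect (U x).
      have [r /= r0 rU] : nbhs_ball x U by apply/nbhs_ballP; exact: open_nbhs_nbhs.
      exists r => // u v u0 ux xv vb xru vxr.
      have uv := le_trans ux xv.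
      exists [:: (u, v)]; split.
      + by rewrite /= uv !lexx.
      + by [].
      + rewrite big_seq1/=.
        have /(congr1 fine) /= -> := MD u v u0 uv.
        rewrite fineD//; last first.
          by rewrite ge0_fin_numE// (le_lt_trans _ (lt_trans muU (ltry _)))//;
            apply: le_measure; rewrite ?inE//; exact: measurableI.
        rewrite [fine (M u)%:E]/= [leRHS]addrC addKr.
        rewrite (_ : U `&` `]u, v] = `]u, v]%classic); last first.
          apply/setIidPr => y; rewrite /= in_itv/= => /andP[uy yv].
          by apply: rU; rewrite /ball/= ltr_distlC; apply/andP; split; lra.
        rewrite lebesgue_measure_itv/= lte_fin; case: ifP => //= /negbT.
        by rewrite -leNgt; lra.
      + rewrite big_seq1/=; have := ndF _ _ uv.
        have := ler_norm (f v - f u).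
        have : 0 <= e / 2 * (v - u) by rewrite mulr_ge0 ?subr_ge0// ltW.
        lra.
    have : x \in `[0, 1]%R -> exists l l' : R,
        [/\ is_derive x 1 F l, is_derive x 1 f l' & l' <= l].
      by apply: contrapT => /NU.
    case=> [|l [l' [dF df ll']]].
      by rewrite in_itv/= x0 (le_trans xb).
    have dG : is_derive x 1 (F - f) (l - l') by apply: is_deriveB.
    have ll0 : 0 <= l - l' by rewrite subr_ge0.
    have [r r0 h] := derive_ge0_local dG ll0 e20.
    exists r => // u v u0 ux xv vb xru vxr.
    exists [::]; split => //.
    + by rewrite big_nil subr_ge0 Mle// (le_trans ux).
    + rewrite big_nil addr0.
      have := h u v ux xv xru vxr; rewrite !fctE; lra.
case: Q0b => s [s1 s2 s3 s4].
have : \sum_(p <- s) `|f p.2 - f p.1| < e / 2.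
  pose nu i := nth (0, 0) s i.
  rewrite (big_nth (0, 0)) big_mkord.
  apply: (acd (size s) (fun i => (nu i).1) (fun i => (nu i).2)).
  + move=> i; have := allP s1 _ (mem_nth (0, 0) (ltn_ord i)).
    by case/and3P => -> -> pb; split => //; split => //; exact: le_trans pb b1.
  + apply/trivIsetP => i j _ _; wlog ij : i j / (i < j)%N.
      move=> h ineqj; have := ineqj; rewrite neq_ltn => /orP[ij|ji]; first exact: h.
      by rewrite setIC; apply: h; rewrite // eq_sym.
    move=> _; apply/seteqP; split => // y [] /=; rewrite !in_itv/=.
    move=> /andP[_ yi] /andP[jy _].
    have /pairwiseP-/(_ (0, 0) i j) := s2.
    rewrite !inE !ltn_ord => /(_ isT isT ij) ij'.
    by have := lt_trans yi (le_lt_trans ij' jy); rewrite ltxx.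
  + have := s3; rewrite (big_nth (0, 0)) big_mkord => /le_lt_trans; apply.
    have -> : M 0 = 0 by rewrite /M set_itvoc0 setI0 measure0.
    rewrite subr0 -lte_fin /M fineK//; apply: le_lt_trans muU.
    by apply: le_measure; rewrite ?inE//; exact: measurableI.
have : e / 2 * b <= e / 2 by rewrite ler_piMr// ltW.
move: s4; rewrite subr0; lra.
Qed.

(** Compares [f] with the primitive of [phi], which is monotone since [phi] is nonnegative and has
    derivative [phi] almost everywhere on the unit interval. *)
Lemma ac_le_integral (f phi : R -> R) (b L : R) : 0 <= b -> b <= 1 ->
  absolutely_continuous 0 1 f ->
  measurable_fun (`[0, 1] : set R) phi -> (forall s, 0 <= phi s) ->
  (\int[leb]_(s in (`[0%R, 1%R] : set R)) (phi s)%:E <= L%:E)%E ->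
  {ae leb, forall s : R, s \in `[0, 1]%R ->
     exists2 l : R, is_derive s 1 f l & l <= phi s} ->
  f b - f 0 <= L.
Proof.
move=> b0 b1 acf mphi phi0 intL aeP.
have iphi : leb.-integrable `[0, 1] (EFin \o phi).
  apply/integrableP; split; first exact/measurable_EFinP.
  under eq_integral => x _ do rewrite /= ger0_norm//.
  exact: le_lt_trans intL (ltry _).
(* Extension by zero, so that the primitive [F] can be taken over half-lines []-oo, x]]; its values
   then lie between 0 and [L]. *)
pose phi1 := phi \_ (`[0, 1] : set R).
have phi10 s : 0 <= phi1 s by rewrite /phi1 patchE; case: ifP.
have iphi1 : leb.-integrable setT (EFin \o phi1).
  have := (integrable_mkcond (mu := leb) (EFin \o phi) (measurable_itv _)).1 iphi.
  by rewrite restrict_EFin.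
have iphi1' y : leb.-integrable `]-oo, y] (EFin \o phi1).
  exact: integrableS iphi1.
have := FTC1Ny iphi1' (integrable_locally (measurable_itv _) iphi).
set F := fun x : R => (\int[leb]_(t in _) _)%R => aeF.
have ndF : {homo F : x y / x <= y}.
  move=> x y xy; rewrite /F /Rintegral fine_le//.
  - exact: integrable_fin_num.
  - exact: integrable_fin_num.
  apply: ge0_subset_integral => //.
  - by apply: measurable_int; exact: iphi1'.
  - by move=> s _; rewrite /= lee_fin.
  - by apply: subset_itvl; rewrite bnd_simp.
have F0 x : 0 <= F x.
  by apply: Rintegral_ge0 => s _.
have FL x : F x <= L.
  rewrite -lee_fin /F /Rintegral fineK; last exact: integrable_fin_num.
  apply: le_trans intL.
  rewrite [leRHS]integral_mkcond restrict_EFin -/phi1.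
  apply: ge0_subset_integral => //.
  - by apply: measurable_int; exact: iphi1.
  - by move=> s _; rewrite /= lee_fin.
have := ac_le_of_derive_le b0 b1 acf ndF _.
suff aeQ : {ae leb, forall s : R, s \in `[0, 1]%R ->
     exists l l' : R, [/\ is_derive s 1 F l, is_derive s 1 f l' & l' <= l]}.
  by move=> /(_ aeQ) /le_trans; apply; have := F0 0; have := FL b; lra.
have FF : Filter (nbhs (almost_everywhere leb)).
  exact: (ae_filter_ringOfSetsType leb).
apply: filterS2 aeF aeP => s [dF DF] h s01.
have [l' df l'phi] := h s01.
exists (phi s), l'; split => //.
apply: DeriveDef => //.
by rewrite -derive1E DF /phi1 patchE mem_set.
Qed.

Lemma ac_norm_le_integral (f phi : R -> R) (b L : R) : 0 <= b -> b <= 1 ->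
  absolutely_continuous 0 1 f ->
  measurable_fun (`[0, 1] : set R) phi -> (forall s, 0 <= phi s) ->
  (\int[leb]_(s in (`[0%R, 1%R] : set R)) (phi s)%:E <= L%:E)%E ->
  {ae leb, forall s : R, s \in `[0, 1]%R ->
     exists2 l : R, is_derive s 1 f l & `|l| <= phi s} ->
  `|f b - f 0| <= L.
Proof.
move=> b0 b1 acf mphi phi0 intL aeP.
have FF : Filter (nbhs (almost_everywhere leb)).
  exact: (ae_filter_ringOfSetsType leb).
have fle : f b - f 0 <= L.
  apply: (ac_le_integral b0 b1 acf mphi phi0 intL).
  apply: filterS aeP => s h /h[l dl hl]; exists l => //.
  exact: le_trans (ler_norm _) hl.
suff : (- f) b - (- f) 0 <= L.
  by rewrite !fctE => ?; rewrite ler_norml; apply/andP; split; lra.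
apply: (ac_le_integral b0 b1 _ mphi phi0 intL).
  move=> e e0; have [d d0 h] := acf e e0; exists d => // k u v uv tr sd.
  by under eq_bigr do rewrite !fctE -opprD normrN; exact: h.
apply: filterS aeP => s h /h[l dl hl]; exists (- l); first exact: is_deriveN.
by apply: le_trans hl; rewrite -normrN ler_norm.
Qed.

End real_line.

(** * Horizontal curves and the quotient distance *)

Section horizontal_curves.
Context {R : realType} {n : nat}.
Local Notation vec := 'rV[R]_(n + n).
Local Notation H := (heis R n).
Local Notation leb := (@lebesgue_measure R).
Implicit Types (z w u : vec) (p q : H) (V : {vspace vec}) (a b : 'I_n -> R -> R).

(** The controls as one vector of the horizontal plane, whose Euclidean norm is the integrand of
    [horizontal_length]. *)
Definition control_vec a b (s : R) : vec :=
  row_mx (\row_j a j s) (\row_j b j s).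

Lemma velocityE a b (s : R) p :
  \sum_(j < n) (a j s *: Xfield j p + b j s *: Yfield j p) =
  (control_vec a b s, omega p.1 (control_vec a b s) / 2) :> H.
Proof.
have fstE (F : 'I_n -> H) : (\sum_j F j).1 = \sum_j (F j).1.
  by apply: (big_morph (fun x : H => x.1)).
have sndE (F : 'I_n -> H) : (\sum_j F j).2 = \sum_j (F j).2.
  by apply: (big_morph (fun x : H => x.2)).
rewrite [LHS]surjective_pairing fstE sndE; congr (_, _).
  have XYE j : (a j s *: Xfield j p + b j s *: Yfield j p).1 =
      row_mx (a j s *: delta_mx 0 j) (b j s *: delta_mx 0 j).
    by rewrite /= !scale_row_mx add_row_mx !scaler0 addr0 add0r.
  under eq_bigr do rewrite XYE.
  apply/rowP => i; rewrite summxE; case: (splitP i) => k ik.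
    have -> : i = lshift n k by apply/val_inj.
    under eq_bigr do rewrite row_mxEl mxE.
    rewrite row_mxEl mxE (bigD1 k)//= big1 ?addr0.
      by rewrite mxE !eqxx mulr1.
    by move=> j jk; rewrite mxE (eq_sym k) (negbTE jk) andbF mulr0.
  have -> : i = rshift n k by apply/val_inj.
  under eq_bigr do rewrite row_mxEr mxE.
  rewrite row_mxEr mxE (bigD1 k)//= big1 ?addr0.
    by rewrite mxE !eqxx mulr1.
  by move=> j jk; rewrite mxE (eq_sym k) (negbTE jk) andbF mulr0.
rewrite /omega mulr_suml; apply: eq_bigr => j _.
rewrite /= /control_vec row_mxKl row_mxKr !mxE /GRing.scale/=; ring.
Qed.

Lemma sqr_control_vec a b (s : R) :
  Num.sqrt (\sum_(j < n) (a j s ^+ 2 + b j s ^+ 2)) = l2 (control_vec a b s).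
Proof.
rewrite /l2 /dot big_split_ord/= big_split/=; congr (Num.sqrt (_ + _)).
  by apply: eq_bigr => j _; rewrite row_mxEl mxE expr2.
by apply: eq_bigr => j _; rewrite row_mxEr mxE expr2.
Qed.

Lemma dcc_ge0 p q : (0 <= dcc p q)%E.
Proof.
apply: le_ereal_inf_tmp => _ [g [a [b [_ _ _ ->]]]].
by apply: integral_ge0 => s _; rewrite lee_fin sqrtr_ge0.
Qed.

Lemma quotient_dist_ge0 V p q : (0 <= quotient_dist V p q)%E.
Proof. by apply: le_ereal_inf_tmp => _ [h _ <-]; exact: dcc_ge0. Qed.

Lemma absolutely_continuous_line (W : normedModType R) (x y : W) :
  absolutely_continuous 0 1 (fun s : R => x + s *: y).
Proof.
move=> e e0; have y0 : 0 < `|y| + 1 by rewrite ltr_wpDl.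
exists (e / (`|y| + 1)); first by rewrite divr_gt0.
move=> k u v uv _ sumd.
under eq_bigr => i _.
  rewrite opprD addrACA subrr add0r -scalerBl normrZ ger0_norm; last first.
    by rewrite subr_ge0; have [_ []] := uv i.
  over.
rewrite -mulr_suml; apply: (@le_lt_trans _ _ ((\sum_i (v i - u i)) * (`|y| + 1))).
  rewrite ler_wpM2l ?lerDl//; apply: sumr_ge0 => i _.
  by rewrite subr_ge0; have [_ []] := uv i.
by rewrite -ltr_pdivlMr.
Qed.

Lemma is_derive_line (W : normedModType R) (x y : W) (s : R) :
  is_derive s 1 (fun s : R => x + s *: y) y.
Proof.
have cv : (fun h : R => h^-1 *: (((fun s : R => x + s *: y) \o shift s) (h *: 1)
    - (x + s *: y))) @ 0^' --> y.
  apply: cvg_near_cst; near=> h.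
  have h0 : h != 0 by near: h; exact: nbhs_dnbhs_neq.
  rewrite /= [h *: 1]mulr1 opprD addrACA subrr add0r -scalerBl addrK.
  by rewrite scalerA mulVf// scale1r.
apply: DeriveDef; first by apply/cvg_ex; exists y.
exact/cvg_lim.
Unshelve. all: by end_near. Qed.

(** With constant controls [u] the straight segment is horizontal: [omega (z + s *: u) u] does not
    depend on [s] because [omega u u] vanishes. *)
Lemma dcc_segment z u (t : R) :
  (@dcc R n (z, t) (z + u, t + omega z u / 2)%R <= (l2 u)%:E)%E.
Proof.
pose D : H := (u, omega z u / 2).
pose g (s : R) : H := (z, t) + s *: D.
pose a (j : 'I_n) (s : R) := u 0 (lshift n j).
pose b (j : 'I_n) (s : R) := u 0 (rshift n j).
have cE s : control_vec a b s = u.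
  apply/rowP => i; case: (splitP i) => k ik.
    have -> : i = lshift n k by apply/val_inj.
    by rewrite row_mxEl mxE.
  have -> : i = rshift n k by apply/val_inj.
  by rewrite row_mxEr mxE.
apply: ereal_inf_lbound; exists g, a, b; split.
- split.
  + exact: absolutely_continuous_line.
  + by move=> j; split; exact: measurable_cst.
  + apply: aeW => s _; rewrite velocityE cE.
    rewrite (_ : (_, _) = D); first exact: is_derive_line.
    congr (_, _); rewrite /g /= omegaDl omegaZl omegazz; congr (_ / _).
    by rewrite mulr0 addr0.
- by rewrite /g scale0r addr0.
- by rewrite /g scale1r.
- rewrite /horizontal_length.
  under eq_integral => s _ do rewrite sqr_control_vec cE.
  rewrite (integral_cst leb)//= lebesgue_measure_itv/= lte_fin ltr01.
  by rewrite oppr0 adde0 mule1.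
Qed.


(* The segment in direction [p'.1 - p.1 - q] issued from [q * p] ends at height
   [p.2 + omega q (p.1 + p'.1) / 2 + omega p.1 p'.1 / 2]; with [q = c *: v],
   this is solved for [c]. *)
Lemma quotient_dist_le V p p' v : v \in V -> omega v (p.1 + p'.1) != 0 ->
  (quotient_dist V p p' <= (l2 (p'.1 - p.1 -
     ((2 * (p'.2 - p.2) - omega p.1 p'.1) / omega v (p.1 + p'.1)) *: v))%:E)%E.
Proof.
move=> vV om0; set c := _ / _; pose q : H := (c *: v, 0).
apply: (@le_trans _ _ (dcc (heis_mul q p) p')).
  by apply: ereal_inf_lbound; exists q => //; split => //; exact: memvZ.
have cE : c * omega v (p.1 + p'.1) = 2 * (p'.2 - p.2) - omega p.1 p'.1.
  by rewrite /c divfK.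
set u := p'.1 - p.1 - c *: v.
rewrite (_ : p' = ((q.1 + p.1) + u,
   (q.2 + p.2 + omega q.1 p.1 / 2) + omega (q.1 + p.1) u / 2)).
  exact: dcc_segment.
rewrite [LHS]surjective_pairing /u /q /=; congr (_, _).
  by apply/rowP => i; rewrite !mxE; ring.
rewrite omegaDr in cE.
rewrite !(omegaDl, omegaDr, omegaNr, omegaZl, omegaZr) !omegazz (omegaC p.1 v).
lra.
Qed.

(** In the bound of [quotient_dist_le] the coefficient of [v] has denominator at least [2 * eta] and
    a numerator of the order of the Euclidean distance. *)
Lemma quotient_dist_lipschitz V (A : set H) v (eta M : R) :
  v \in V -> 0 < eta -> 0 <= M ->
  (forall p, A p -> eta <= omega v p.1 /\ l2 p.1 <= M) ->
  exists2 L : R, 0 < L & forall p p', A p -> A p' ->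
    (quotient_dist V p p' <= L%:E * eucl_dist p p')%E.
Proof.
move=> vV eta0 M0 hA.
pose N : R := (2 * n)%:R; have N0 : 0 <= N by [].
pose K := (2 + N * M) / (2 * eta).
have K0 : 0 <= K by rewrite divr_ge0 ?addr_ge0 ?mulr_ge0 ?(ltW eta0).
exists ((n + n)%:R * (1 + K * l2 v) + 1).
  by rewrite ltr_wpDl// mulr_ge0// addr_ge0// mulr_ge0// l2_ge0.
move=> p p' /hA[ep pM] /hA[ep' p'M].
have om0 : 2 * eta <= omega v (p.1 + p'.1) by rewrite omegaDr; lra.
have om1 : 0 < omega v (p.1 + p'.1) by apply: lt_le_trans om0; rewrite mulr_gt0.
apply: le_trans (quotient_dist_le vV (lt0r_neq0 om1)) _.
rewrite eucl_distE lee_fin.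
set c := _ / _; set e := ed p p'.
have e0 : 0 <= e by exact: sqrtr_ge0.
have cK : `|c| <= K * e.
  rewrite /c normrM normfV (gtr0_norm om1) ler_pdivrMr//.
  apply: (@le_trans _ _ ((2 + N * M) * e)); last first.
    have -> : (2 + N * M) * e = K * e * (2 * eta).
      by rewrite /K mulrAC divfK// gt_eqF// mulr_gt0.
    by rewrite ler_wpM2l// mulr_ge0.
  apply: le_trans (ler_normB _ _) _; rewrite [leRHS]mulrDl lerD//.
    by rewrite normrM ger0_norm// ler_wpM2l// distrC abs_le_ed.
  (* Subtracting [omega p.1 p.1], which is 0, brings out the small factor [p'.1 - p.1]. *)
  have -> : omega p.1 p'.1 = omega p.1 (p'.1 - p.1).
    by rewrite omegaDr omegaNr omegazz oppr0 addr0.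
  apply: le_trans (omega_le _ _) _; rewrite -mulrA ler_wpM2l//.
  rewrite ler_pM ?l2_ge0// (le_trans _ (l2_le_ed p p'))//.
  by rewrite -opprB l2N.
apply: (@le_trans _ _ ((n + n)%:R * ((1 + K * l2 v) * e))); last first.
  by rewrite [leRHS]mulrDl mul1r mulrA lerDl.
apply: l2_le_coord => i; rewrite !mxE.
apply: le_trans (ler_normB _ _) _; rewrite [leRHS]mulrDl mul1r lerD//.
  have := coord_le_l2 (p.1 - p'.1) i; rewrite !mxE distrC => /le_trans; apply.
  exact: l2_le_ed.
by rewrite normrM mulrAC ler_pM// coord_le_l2.
Qed.

(** The Lipschitz constant depends on a bound for the points, so [A] is exhausted by countably many
    bounded parts. *)
Lemma small_covers_quotient V (A : set H) v (eta s : R) : 0 <= s ->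
  v \in V -> 0 < eta -> (forall p, A p -> eta <= omega v p.1) ->
  small_covers eucl_dist s A -> small_covers (quotient_dist V) s A.
Proof.
move=> s0 vV eta0 hA cA.
pose B (k : nat) := A `&` [set p | l2 p.1 <= k%:R].
apply: (@small_covers_subset _ _ _ _ _ (\bigcup_k B k)).
  move=> p Ap; exists (Num.bound (l2 p.1)) => //; split => //=.
  by rewrite ltW// (le_lt_trans _ (archi_boundP _))// l2_ge0.
apply: small_covers_bigcup => k.
have [|L L0 hL] := @quotient_dist_lipschitz V (B k) v eta k%:R vV eta0 (ler0n _ _).
  by move=> p [Ap pk]; split => //; exact: hA.
apply: small_covers_lipschitz hL _ => //.
- exact: quotient_dist_ge0.
- exact: eucl_dist_ge0.
- by apply: small_covers_subset cA => p [].
Qed.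

End horizontal_curves.

(** * Displacement along horizontal curves of bounded length *)

Section length_bounds.
Context {R : realType} {n : nat}.
Local Notation vec := 'rV[R]_(n + n).
Local Notation H := (heis R n).
Local Notation leb := (@lebesgue_measure R).
Implicit Types (z w u : vec) (p q : H) (V : {vspace vec}) (a b : 'I_n -> R -> R).

Lemma absolutely_continuous_linear (W : normedModType R) (l : {linear W -> R^o})
    (C : R) (g : R -> W) :
  (forall x, `|l x| <= C * `|x|) -> absolutely_continuous 0 1 g ->
  absolutely_continuous 0 1 (l \o g : R -> R^o).
Proof.
move=> lC acg e e0; have C0 : 0 < `|C| + 1 by rewrite ltr_wpDl.
have [d d0 hd] := acg (e / (`|C| + 1)) (divr_gt0 e0 C0); exists d => // k u v uv tr sd.
have := hd k u v uv tr sd; rewrite ltr_pdivlMr// => /(le_lt_trans _); apply.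
rewrite mulr_suml; apply: ler_sum => i _ /=.
rewrite -linearB (le_trans (lC _))// mulrC ler_wpM2l//.
by rewrite (le_trans (ler_norm C))// lerDl.
Qed.

Lemma is_derive_linear (W : normedModType R) (l : {linear W -> R^o}) (C : R)
    (g : R -> W) (s : R) (D : W) :
  (forall x, `|l x| <= C * `|x|) -> is_derive s 1 g D ->
  is_derive s 1 (l \o g : R -> R^o) (l D).
Proof.
move=> lC [dg Dg].
have lcont : continuous l.
  apply: bounded_linear_continuous; apply/bounded_funP => r.
  exists (`|C| * `|r|) => x xr; rewrite (le_trans (lC x))//.
  by rewrite (le_trans (ler_norm _))// normrM ler_wpM2l// normr_id (le_trans xr)// ler_norm.
have cv : (fun h : R => h^-1 *: (((l \o g : R -> R^o) \o shift s) (h *: 1)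
    - (l \o g) s)) @ 0^' --> l D.
  rewrite (_ : (fun _ => _) =
      l \o (fun h : R => h^-1 *: ((g \o shift s) (h *: 1) - g s))); last first.
    by apply/funext => h /=; rewrite linearZ/= (linearB l).
  apply: continuous_cvg; first exact: lcont.
  by rewrite -Dg; move: dg; rewrite /derivable; move/cvg_ex => [x hx];
     rewrite /derive; move/cvg_lim: (hx) => ->.
apply: DeriveDef; first by apply/cvg_ex; exists (l D).
exact/cvg_lim.
Qed.

Definition horizontal_coord (i : 'I_(n + n)) (p : H) : R^o := p.1 0 i.

Lemma horizontal_coord_is_linear i : linear (horizontal_coord i).
Proof. by move=> c p q; rewrite /horizontal_coord !mxE. Qed.

HB.instance Definition _ i :=
  GRing.isLinear.Build R H R^o _ (horizontal_coord i)
    (horizontal_coord_is_linear i).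

(* Linear in the point because [z] is kept fixed (the starting point of the
   curve), so that the bounds for linear functionals apply. *)
Definition relative_height z (p : H) : R^o := p.2 - omega z p.1 / 2.

Lemma relative_height_is_linear z : linear (relative_height z).
Proof.
move=> c p q; rewrite /relative_height /= omegaDr omegaZr /GRing.scale/=.
ring.
Qed.

HB.instance Definition _ z :=
  GRing.isLinear.Build R H R^o _ (relative_height z)
    (relative_height_is_linear z).

Lemma coord_le_norm p i : `|p.1 0 i| <= `|p|.
Proof.
apply: (@le_trans _ _ `|p.1|); last by rewrite prod_normE le_max lexx.
rewrite [leRHS]mx_normrE.
exact: (@le_bigmax _ _ _ _ (fun ij => `|p.1 ij.1 ij.2|) (0, i)).
Qed.

Lemma horizontal_coord_bound i p : `|horizontal_coord i p| <= 1 * `|p|.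
Proof. by rewrite mul1r; exact: coord_le_norm. Qed.

Lemma relative_height_bound z p :
  `|relative_height z p| <= (1 + (2 * n)%:R * l2 z) * `|p|.
Proof.
apply: le_trans (ler_normB _ _) _; rewrite mulrDl mul1r lerD//.
  by rewrite prod_normE le_max lexx orbT.
have : `|omega z p.1| <= (2 * n)%:R * (l2 z * `|p|).
  by apply: omega_le_coord => i; [exact: coord_le_l2|exact: coord_le_norm].
rewrite normrM (@ger0_norm _ 2^-1)// -mulrA.
by have := normr_ge0 (omega z p.1); lra.
Qed.

(** A bounded functional composed with the curve is absolutely continuous, with derivative the
    functional applied to the velocity. That is at most [K] times the speed, and the speed
    integrates to at most [L]. *)
Lemma curve_functional_bound (l : {linear H -> R^o}) (C K L x : R) g a b :
  (forall p, `|l p| <= C * `|p|) -> 0 <= K -> 0 <= x <= 1 ->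
  horizontal_curve g a b -> (horizontal_length a b <= L%:E)%E ->
  (forall s, s \in `[0, 1]%R ->
    `|l (control_vec a b s, omega (g s).1 (control_vec a b s) / 2)|
      <= K * l2 (control_vec a b s)) ->
  `|l (g x) - l (g 0)| <= K * L.
Proof.
move=> lC K0 /andP[x0 x1] [acg mab deg] lenL lK.
have mphi : measurable_fun (`[0, 1] : set R) (fun s => l2 (control_vec a b s)).
  rewrite (_ : (fun s => _) =
      fun s => Num.sqrt (\sum_(j < n) (a j s ^+ 2 + b j s ^+ 2))); last first.
    by apply/funext => s; rewrite sqr_control_vec.
  apply: (@measurableT_comp _ _ _ _ _ _ (@Num.sqrt R)).
    by apply: continuous_measurable_fun; exact: sqrt_continuous.
  apply: measurable_sum => j; have [ma mb] := mab j.
  by apply: measurable_funD; exact: measurable_funX.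
have mKphi : measurable_fun (`[0, 1] : set R)
    (fun s => K * l2 (control_vec a b s)).
  by apply: measurable_funM => //; exact: measurable_cst.
have intKphi : (\int[leb]_(s in (`[0%R, 1%R] : set R))
    (K * l2 (control_vec a b s))%:E <= (K * L)%:E)%E.
  under eq_integral => s _ do rewrite EFinM -sqr_control_vec.
  rewrite ge0_integralZl_EFin//; first by rewrite EFinM lee_wpmul2l.
  apply/measurable_EFinP.
  rewrite (_ : (fun s => Num.sqrt _) = fun s => l2 (control_vec a b s))//.
  by apply/funext => s; rewrite sqr_control_vec.
apply: (ac_norm_le_integral x0 x1 (absolutely_continuous_linear lC acg) mKphi _ intKphi).
  by move=> s; rewrite mulr_ge0// l2_ge0.
apply: filterS deg; first exact: (ae_filter_ringOfSetsType leb).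
move=> s h s01; have := h s01; rewrite velocityE => dg.
eexists; first exact: (is_derive_linear lC dg).
exact: lK.
Qed.

(** Each horizontal coordinate moves by at most [L]. The relative height therefore changes at a rate
    of order [L] times the speed, and integrating gives the second factor [L]. *)
Lemma horizontal_curve_bounds (L : R) g a b :
  horizontal_curve g a b -> (horizontal_length a b <= L%:E)%E ->
  (forall i, `|((g 1).1 - (g 0).1) 0 i| <= L) /\
  `|(g 1).2 - (g 0).2 - omega (g 0).1 (g 1).1 / 2| <= n%:R * L ^+ 2.
Proof.
move=> hg lenL.
have L0 : 0 <= L.
  rewrite -lee_fin; apply: le_trans lenL.
  by apply: integral_ge0 => s _; rewrite lee_fin sqrtr_ge0.
have hcoord (x : R) i : 0 <= x <= 1 -> `|(g x).1 0 i - (g 0).1 0 i| <= L.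
  move=> x01.
  have := curve_functional_bound (horizontal_coord_bound i) ler01 x01 hg lenL.
  rewrite !mul1r; apply => s _; rewrite mul1r; exact: coord_le_l2.
split=> [i|]; first by rewrite !mxE; apply: hcoord; rewrite ler01 lexx.
have i1 : (0 : R) <= (1 : R) <= 1 by rewrite ler01/=.
have nL0 : 0 <= n%:R * L by rewrite mulr_ge0.
have := curve_functional_bound (relative_height_bound (g 0).1) nL0 i1 hg lenL.
rewrite -mulrA -expr2 /= /relative_height/= omegazz mul0r subr0.
rewrite addrAC; apply => s s01.
set u := control_vec a b s.
have -> : omega (g s).1 u / 2 - omega (g 0).1 u / 2 = omega ((g s).1 - (g 0).1) u / 2.
  by rewrite omegaDl omegaNl mulrBl.
have : `|omega ((g s).1 - (g 0).1) u| <= (2 * n)%:R * (L * l2 u).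
  apply: omega_le_coord => i; last exact: coord_le_l2.
  by rewrite !mxE; apply: hcoord; move: s01; rewrite in_itv.
by rewrite normrM (@ger0_norm _ 2^-1)// natrM; lra.
Qed.

End length_bounds.

(** * Euclidean distance controlled by the quotient distance *)

Section quotient_lower_bound.
Context {R : realType} {n : nat}.
Local Notation vec := 'rV[R]_(n + n).
Local Notation H := (heis R n).
Implicit Types (z w u : vec) (p q : H) (V : {vspace vec}).

(** Take a curve of length at most [L] from [heis_mul q p] to [p']. Its horizontal displacement is
    the difference of [p'.1 - p.1], orthogonal to [V], and [q.1], in [V]; so both are of order [L].
    The height then changes by a term in [L ^+ 2] and three [omega] terms of order [M * L]. *)
Lemma ed_le_of_quotient_lt V (M L : R) p p' : 0 <= M ->
  p.1 \in orthov (@dot R (n + n)) V -> p'.1 \in orthov (@dot R (n + n)) V ->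
  l2 p.1 <= M -> l2 p'.1 <= M -> `|p.2| <= M -> `|p'.2| <= M ->
  (quotient_dist V p p' < L%:E)%E ->
  ed p p' <= (3 * n%:R + 2 * M + 6 * n%:R ^+ 2 * M) * L.
Proof.
move=> M0 pV p'V pM p'M p2M p'2M.
move=> /ereal_inf_lt[_ [q [qV q2]] <-].
move=> /ereal_inf_lt[_ [g [a [b [hg g0 g1 ->]]]]] /ltW lenL.
have [coordL heightL] := horizontal_curve_bounds hg lenL.
have L0 : 0 <= L.
  rewrite -lee_fin; apply: le_trans lenL.
  by apply: integral_ge0 => s _; rewrite lee_fin sqrtr_ge0.
have N0 : 0 <= n%:R :> R by [].
(* The factor is the cost of passing from bounds on the [n + n] coordinates to the Euclidean
   norm. *)
pose D := 2 * n%:R * L.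
have D0 : 0 <= D by rewrite /D !mulr_ge0.
have uE : (g 1).1 - (g 0).1 = (p'.1 - p.1) - q.1.
  by rewrite g1 g0 /= opprD addrA addrAC.
have uD : l2 ((g 1).1 - (g 0).1) <= D.
  by apply: le_trans (l2_le_coord coordL) _; rewrite /D natrD mulr_natl mulr2n.
have orth : dot (p'.1 - p.1) q.1 = 0.
  have wV : p'.1 - p.1 \in orthov (@dot R (n + n)) V by exact: memvB.
  exact: (mem_orthovP wV).
have dotu : dot ((g 1).1 - (g 0).1) ((g 1).1 - (g 0).1) =
    dot (p'.1 - p.1) (p'.1 - p.1) + dot q.1 q.1.
  rewrite uE; exact: hnormBd.
have qD : l2 q.1 <= D.
  by apply: le_trans uD; rewrite ler_wsqrtr// dotu lerDr dot_ge0.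
have wD : l2 (p'.1 - p.1) <= D.
  by apply: le_trans uD; rewrite ler_wsqrtr// dotu lerDl dot_ge0.
have h3 (x y : vec) : l2 x <= D -> l2 y <= M -> `|omega x y| <= 2 * n%:R * (D * M).
  move=> xD yM; apply: le_trans (omega_le _ _) _; rewrite natrM.
  by rewrite ler_wpM2l ?mulr_ge0// ler_pM ?l2_ge0.
have hw : `|omega p.1 p'.1| <= 2 * n%:R * (D * M).
  have -> : omega p.1 p'.1 = - omega (p'.1 - p.1) p.1.
    by rewrite omegaC omegaDl omegaNl omegazz subr0.
  by rewrite normrN; exact: h3.
have hq := h3 _ _ qD pM; have hq' := h3 _ _ qD p'M.
have heightD : `|p'.2 - p.2| <= n%:R * L ^+ 2 + 3 * (n%:R * (D * M)).
  move: heightL; rewrite g1 g0 /= q2 add0r omegaDl => heightL.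
  have -> : p'.2 - p.2 = (p'.2 - (p.2 + omega q.1 p.1 / 2) -
      (omega q.1 p'.1 + omega p.1 p'.1) / 2) +
      (omega q.1 p.1 + omega q.1 p'.1 + omega p.1 p'.1) / 2 by field.
  apply: le_trans (ler_normD _ _) _; apply: lerD => //.
  rewrite normrM (@ger0_norm _ 2^-1)// ler_pdivrMr//.
  apply: le_trans (ler_normD _ _) _.
  have := ler_normD (omega q.1 p.1) (omega q.1 p'.1).
  lra.
apply: le_trans (ed_le _ _) _.
have -> : l2 (p.1 - p'.1) = l2 (p'.1 - p.1) by rewrite -l2N opprB.
rewrite distrC.
have nL : 0 <= n%:R * L by rewrite mulr_ge0.
have nML : 0 <= n%:R ^+ 2 * M * L by rewrite !mulr_ge0// sqr_ge0.
have ML : 0 <= M * L by rewrite mulr_ge0.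
(* For [L] at most 1 the quadratic term is absorbed by a linear one. For larger [L] the height
   difference is at most [2 * M], hence at most [2 * M * L]. *)
have [L1|L1] := leP L 1.
  have : n%:R * L ^+ 2 <= n%:R * L.
    by rewrite ler_wpM2l// expr2 ler_piMl.
  have DE : 3 * (n%:R * (D * M)) = 6 * (n%:R ^+ 2 * M * L) by rewrite /D; ring.
  by rewrite /D in wD; lra.
have : `|p'.2 - p.2| <= 2 * M.
  by apply: le_trans (ler_normB _ _) _; lra.
have : 2 * M <= 2 * (M * L) by rewrite ler_wpM2l// ler_peMr// ltW.
by rewrite /D in wD; lra.
Qed.

Lemma small_covers_eucl V (A : set H) (s : R) : 0 <= s ->
  (forall p, A p -> p.1 \in orthov (@dot R (n + n)) V) ->
  small_covers (quotient_dist V) s A -> small_covers eucl_dist s A.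
Proof.
move=> s0 AV cA.
pose B (k : nat) := A `&` [set p | l2 p.1 <= k%:R /\ `|p.2| <= k%:R].
apply: (@small_covers_subset _ _ _ _ _ (\bigcup_k B k)).
  move=> p Ap; exists (Num.bound (l2 p.1 + `|p.2|)) => //; split => //=.
  have : l2 p.1 + `|p.2| < (Num.bound (l2 p.1 + `|p.2|))%:R.
    by rewrite archi_boundP// addr_ge0// l2_ge0.
  by have := l2_ge0 p.1; have := normr_ge0 p.2; split; lra.
apply: small_covers_bigcup => k.
pose C : R := 3 * n%:R + 2 * k%:R + 6 * n%:R ^+ 2 * k%:R + 1.
have C0 : 0 < C.
  by rewrite ltr_wpDl// !addr_ge0// !mulr_ge0// sqr_ge0.
apply: (small_covers_lipschitz (d' := quotient_dist V) (L := C)) => //.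
- exact: eucl_dist_ge0.
- exact: quotient_dist_ge0.
- move=> p p' [Ap [p1 p2]] [Ap' [p'1 p'2]].
  have := @quotient_dist_ge0 _ _ V p p'.
  case E : (quotient_dist V p p') => [x| |]//; last first.
    by move=> _; rewrite gt0_muley ?lte_fin ?leey.
  rewrite lee_fin => x0; rewrite eucl_distE -EFinM lee_fin.
  (* The infimum defining the quotient distance need not be attained, hence the margin [e / C]. *)
  apply/ler_addgt0Pr => e e0.
  have lt : (quotient_dist V p p' < (x + e / C)%:E)%E.
    by rewrite E lte_fin ltrDl divr_gt0.
  have := ed_le_of_quotient_lt (ler0n R k) (AV _ Ap) (AV _ Ap') p1 p'1 p2 p'2 lt.
  move=> /le_trans; apply.
  apply: (@le_trans _ _ (C * (x + e / C))).
    by rewrite ler_wpM2r ?lerDl// addr_ge0// divr_ge0// ltW.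
  by rewrite mulrDr mulrCA divff ?mulr1// gt_eqF.
- by apply: small_covers_subset cA => p [].
Qed.

End quotient_lower_bound.

(** * Unitary invariance *)

Section unitary_symplectic.
Context {R : realType} {n : nat}.
Local Notation vec := 'rV[R]_(n + n).
Implicit Types (z w u v : vec) (V W : {vspace vec}) (U : 'M[R[i]]_n).

Lemma Re_sum (I : Type) (r : seq I) (P : pred I) (F : I -> R[i]) :
  complex.Re (\sum_(k <- r | P k) F k) = \sum_(k <- r | P k) complex.Re (F k).
Proof. by apply: (big_morph (@complex.Re R)) => // -[? ?] [? ?]. Qed.

Lemma Im_sum (I : Type) (r : seq I) (P : pred I) (F : I -> R[i]) :
  complex.Im (\sum_(k <- r | P k) F k) = \sum_(k <- r | P k) complex.Im (F k).
Proof. by apply: (big_morph (@complex.Im R)) => // -[? ?] [? ?]. Qed.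

(** Real and imaginary parts of the identity expressing that [U] times its adjoint is 1, with
    [U = P + i Q]. *)
Lemma unitary_blocks U : U \is unitarymx ->
  let P := map_mx (@complex.Re R) U in let Q := map_mx (@complex.Im R) U in
  P *m P^T + Q *m Q^T = 1%:M /\ Q *m P^T = P *m Q^T.
Proof.
move=> /unitarymxP UU P Q.
have entry i j : \sum_k U i k * conjc (U j k) = (i == j)%:R.
  have /matrixP/(_ i j) := UU; rewrite !mxE => <-.
  by apply: eq_bigr => k _; rewrite !mxE.
split; apply/matrixP => i j.
  have /(congr1 (@complex.Re R)) := entry i j; rewrite Re_sum !mxE.
  rewrite (_ : complex.Re _ = (i == j)%:R :> R); last by case: (i == j).
  move=> <-; rewrite -big_split; apply: eq_bigr => k _; rewrite !mxE.
  by case: (U i k) (U j k) => a b [c d] /=; ring.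
have /(congr1 (@complex.Im R)) := entry i j; rewrite Im_sum !mxE.
rewrite (_ : complex.Im _ = 0 :> R); last by case: (i == j).
move=> e; apply/eqP; rewrite -subr_eq0; apply/eqP; apply: etrans e.
rewrite -sumrB; apply: eq_bigr => k _; rewrite !mxE.
by case: (U i k) (U j k) => a b [c d] /=; ring.
Qed.

Definition symplectic_mx : 'M[R]_(n + n) := block_mx 0 1%:M (- 1%:M) 0.

Lemma omega_mx z w : omega z w = (z *m symplectic_mx *m w^T) 0 0.
Proof.
rewrite -[in RHS](hsubmxK z) -[in RHS](hsubmxK w) tr_row_mx mul_row_block.
rewrite !mulmx0 mulmx1 mulmxN mulmx1 add0r addr0 mul_row_col mxE.
rewrite [X in X + _]mxE [X in _ + X]mxE addrC -big_split.
by apply: eq_bigr => j _; rewrite !mxE/= mulNr.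
Qed.

Lemma realify_symplectic U : U \is unitarymx ->
  realify U *m symplectic_mx *m (realify U)^T = symplectic_mx.
Proof.
move=> /unitary_blocks; rewrite /realify.
set P := map_mx _ U; set Q := map_mx _ U => -[h1 h2].
rewrite /symplectic_mx mulmx_block tr_block_mx.
rewrite !mulmx0 !mulmx1 !mulmxN !mulmx1 !add0r !addr0 mulmx_block.
rewrite [(- Q)^T]linearN/= !mulNmx !mulmxN !opprK h2 addNr subrr.
by rewrite [Q *m Q^T + _]addrC h1 -opprD h1.
Qed.

Lemma realify_orthogonal U : U \is unitarymx ->
  realify U *m (realify U)^T = 1%:M.
Proof.
move=> /unitary_blocks; rewrite /realify.
set P := map_mx _ U; set Q := map_mx _ U => -[h1 h2].
rewrite tr_block_mx mulmx_block [(- Q)^T]linearN/= !mulNmx !mulmxN opprK.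
by rewrite h2 h1 addNr [Q *m Q^T + _]addrC h1 -scalar_mx_block.
Qed.

Lemma realify_adjoint U :
  realify (map_mx Num.conj U^T) = (realify U)^T.
Proof.
rewrite /realify tr_block_mx [(- map_mx _ _)^T]linearN/=.
congr block_mx; apply/matrixP => i j; rewrite !mxE; case: (U j i) => a b //=.
by rewrite opprK.
Qed.

Lemma omega_realify U z w : U \is unitarymx ->
  omega (z *m realify U) (w *m realify U) = omega z w.
Proof.
move=> hU; rewrite !omega_mx trmx_mul !mulmxA.
by rewrite -(mulmxA z) -(mulmxA z) realify_symplectic.
Qed.

Definition complexify z : 'rV[R[i]]_n :=
  \row_j Complex (z 0 (lshift n j)) (z 0 (rshift n j)).

Lemma complexify_inj : injective complexify.
Proof.
move=> z w /rowP zw; apply/rowP => i; case: (splitP i) => k ik.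
  have -> : i = lshift n k by apply/val_inj.
  by have := zw k; rewrite !mxE => -[].
have -> : i = rshift n k by apply/val_inj.
by have := zw k; rewrite !mxE => -[].
Qed.

Lemma complexify_realify z U : complexify (z *m realify U) = complexify z *m U.
Proof.
apply/rowP => j; rewrite !mxE; apply/eqP; rewrite eq_complex Re_sum Im_sum /=.
rewrite !big_split_ord/= -!big_split/=; apply/andP; split; apply/eqP.
  apply: eq_bigr => k _; rewrite /realify block_mxEul block_mxEdl !mxE.
  by case: (U k j) => a b /=; ring.
apply: eq_bigr => k _; rewrite /realify block_mxEur block_mxEdr !mxE.
by case: (U k j) => a b /=; ring.
Qed.

Lemma complexifyZ (c : R) z : complexify (c *: z) = (c%:C)%C *: complexify z.
Proof.
apply/rowP => j; rewrite !mxE; apply/eqP; rewrite eq_complex /=.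
by rewrite !mul0r subr0 addr0 !eqxx.
Qed.

(** Gram-Schmidt applied to the matrix with all rows equal to [u]: only the first row matters, and
    it spans the same line as [u], with a nonnegative coefficient. *)
Lemma exists_unitary_row0 (u : 'rV[R[i]]_n) (n0 : (0 < n)%N) : u != 0 ->
  exists Q : 'M[R[i]]_n, Q \is unitarymx /\
    exists2 d : R[i], 0 < d & u = d *: row (Ordinal n0) Q.
Proof.
move=> u0; pose A : 'M[R[i]]_n := \matrix_(i, j) u 0 j.
pose i0 := Ordinal n0; pose Q := schmidt A.
have Qu : Q \is unitarymx by exact: schmidt_unitarymx.
exists Q; split => //.
have rA : row i0 A = u by apply/rowP => j; rewrite !mxE.
have := row_schmidt_sub A i0; rewrite rA (big_pred1 i0); last first.
  by move=> k; rewrite /= leqn0 -val_eqE.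
rewrite genmxE => /sub_rVP[d ud]; exists d => //.
have := form1_row_schmidt A i0; rewrite rA -/Q ud linearZl_LR/=.
have /row_unitarymxP -> := Qu; rewrite eqxx mulr1 => d0.
by rewrite lt_neqAle d0 andbT eq_sym; apply: contra u0 => /eqP d00; rewrite ud d00 scale0r.
Qed.

(** Complete both vectors to unitary matrices [Q] and [Q'] with these directions as first rows; the
    adjoint of [Q] times [Q'] carries one row to the other. The scalar is real because both
    coefficients are positive. *)
Lemma unitary_transitive z w : z != 0 -> w != 0 ->
  exists U, U \is unitarymx /\ exists2 c : R, c != 0 & z *m realify U = c *: w.
Proof.
move=> z0 w0.
have n0 : (0 < n)%N.
  rewrite lt0n; apply: contra z0 => /eqP n0; apply/eqP/rowP => i.
  by have := ltn_ord i; rewrite [X in (_ < X + X)%N]n0.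
have c0 : complexify 0 = 0 by apply/rowP => j; rewrite !mxE.
have cplx0 x : x != 0 -> complexify x != 0.
  by apply: contra_neq => cx; apply: complexify_inj; rewrite cx c0.
have [Q [hQ [d d0 zd]]] := exists_unitary_row0 n0 (cplx0 z z0).
have [Q' [hQ' [d' d'0 wd']]] := exists_unitary_row0 n0 (cplx0 w w0).
exists (map_mx Num.conj Q^T *m Q'); split.
  by apply: mul_unitarymx => //; rewrite trmxC_unitary.
have dd0 : 0 < d / d' by rewrite divr_gt0.
have [r rE] := complex_realP _ (gtr0_real dd0).
exists r.
  by move: dd0; rewrite rE; apply: contraTneq => ->; rewrite ltxx.
apply: complexify_inj; rewrite complexify_realify complexifyZ -rE zd wd'.
rewrite mulmxA -!scalemxAl -mulmxA.
rewrite scalerA divfK ?gt_eqF//; congr (_ *: _).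
rewrite !rowE -!mulmxA; congr (_ *m _).
by rewrite mulmxA (unitarymxP hQ) mul1mx.
Qed.

End unitary_symplectic.

(** * The measure of the exceptional subspaces *)

Section isotropic_null_sets.
Context {R : realType} {n m : nat} (mn : (m <= n)%N).
Local Notation vec := 'rV[R]_(n + n).
Local Notation Gr := (GhBorel R mn).
Implicit Types (z w u v : vec) (V W : {vspace vec}) (U : 'M[R[i]]_n).

Lemma dot_cap_orthov V : (V :&: orthov (@dot R (n + n)) V = 0)%VS.
Proof.
apply/eqP; rewrite -subv0; apply/subvP => u; rewrite memv_cap memv0.
by move=> /andP[uV /mem_orthovP/(_ _ uV)/dot_eq0/eqP].
Qed.

(** A dimension count: the orthogonal complement contains the kernel of the map sending [z] to its
    products with a basis of [V]. *)
Lemma dot_add_orthov V : (V + orthov (@dot R (n + n)) V = fullv)%VS.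
Proof.
apply/eqP; rewrite eqEdim subvf dimv_disjoint_sum ?dot_cap_orthov//=.
pose f := linfun (fun z : vec => \row_(i < \dim V) dot z (vbasis V)`_i : 'rV[R]_(\dim V)).
have fE z : f z = \row_(i < \dim V) dot z (vbasis V)`_i.
  rewrite /f; pose g z : 'rV[R]_(\dim V) := \row_i dot z (vbasis V)`_i.
  have lg : linear g by move=> c x y; apply/rowP => i; rewrite !mxE linearPl.
  pose G : {linear vec -> 'rV[R]_(\dim V)} :=
    HB.pack g (GRing.isLinear.Build _ _ _ _ g lg).
  exact: (lfunE G z).
rewrite -(limg_ker_dim f fullv) capfv addnC leq_add//.
  apply: leq_trans (dimvS (subvf _)) _.
  by rewrite dimvf dim_matrix ?mul1r ?mul1n.
apply: dimvS; apply/subvP => z; rewrite memv_ker fE => /eqP/rowP z0.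
apply/mem_orthovP => v vV; rewrite (coord_vbasis vV) linear_sumr big1// => i _.
rewrite linearZr_LR/=; have := z0 i; rewrite !mxE => ->.
by rewrite mulr0.
Qed.

Lemma orth_proj_in V z : orth_proj V z \in V.
Proof. exact: memv_pi. Qed.

Lemma orth_proj_id V z : z \in V -> orth_proj V z = z.
Proof. by apply: daddv_pi_id; exact: dot_cap_orthov. Qed.

Lemma sub_orth_proj_in V z : z - orth_proj V z \in orthov (@dot R (n + n)) V.
Proof.
have zE := daddv_pi_add (dot_cap_orthov V) (_ : z \in _).
rewrite -[X in X - _]zE ?dot_add_orthov ?memvf// addrC addKr.
exact: memv_pi.
Qed.

(** The exceptional subspaces, those inside the symplectic complement of [z]: no direction of such a
    [V] compensates the height at [z]. *)
Definition isotropic_annihilator z : set Gr :=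
  [set V | forall v, v \in Gh_space V -> omega v z = 0].

(** The rows of the projection matrix span [V], so finitely many closed conditions on that matrix
    suffice; measurability follows from this form. *)
Lemma isotropic_annihilatorP z (V : Gr) : isotropic_annihilator z V <->
  forall j, omega (row j (lin1_mx (orth_proj (Gh_space V)))) z = 0.
Proof.
have rowE j : row j (lin1_mx (orth_proj (Gh_space V))) =
    orth_proj (Gh_space V) (delta_mx 0 j).
  by rewrite rowE mul_rV_lin1.
split=> [Vz j|h v vV]; first by rewrite rowE; exact: Vz (orth_proj_in _ _).
rewrite -(orth_proj_id vV) (row_sum_delta v) linear_sum/=.
have osum (I : finType) (F : I -> vec) : omega (\sum_i F i) z = \sum_i omega (F i) z.
  apply: (big_morph (omega^~ z)) => [x y|]; first exact: omegaDl.
  by rewrite -(scale0r (0 : vec)) omegaZl mul0r.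
rewrite osum big1// => j _.
by rewrite linearZ/= omegaZl -rowE h mulr0.
Qed.

Lemma omega_row_continuous z j :
  continuous (fun M : 'M[R]_(n + n) => omega (row j M) z).
Proof.
apply: continuous_big => [|k _]; first exact: add_continuous.
rewrite (_ : (fun N : 'M[R]_(n + n) => _) = fun N => N j (lshift n k) * z 0 (rshift n k) -
    N j (rshift n k) * z 0 (lshift n k)); last by apply/funext => N; rewrite !mxE.
move=> M; have FM : Filter (nbhs M) by exact: nbhs_filter.
apply: (@cvgB _ _ _ (nbhs M) FM); apply: (@cvgM _ _ (nbhs M) FM);
  (exact: coord_continuous || exact: cvg_cst).
Qed.

Lemma measurable_isotropic_annihilator z : measurable (isotropic_annihilator z).
Proof.
rewrite (_ : isotropic_annihilator z =
  \bigcap_(j in [set: 'I_(n + n)])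
    ~` ((fun V : Gh R mn => lin1_mx (orth_proj (val V))) @^-1`
     [set M | omega (row j M) z != 0])).
  apply: fin_bigcap_measurable => [|j _]; first exact: finite_finset.
  apply: measurableC; apply: sub_sigma_algebra.
  exists [set M | omega (row j M) z != 0] => //.
  apply: (@open_comp _ _ (fun M : 'M[R]_(n + n) => omega (row j M) z) [set x | x != 0]).
    by move=> M _; exact: omega_row_continuous.
  exact: open_neq.
apply/seteqP; split => V.
  by move=> /isotropic_annihilatorP h j _; apply/negP; rewrite negbK; apply/eqP/h.
move=> h; apply/isotropic_annihilatorP => j; apply/eqP.
by have /negP := h j I; rewrite negbK.
Qed.

Lemma unitary_imageP U V w :
  reflect (exists2 v, v \in V & w = v *m realify U) (w \in unitary_image U V).
Proof.
by apply: (iffP memv_imgP) => -[v vV ->]; exists v; rewrite ?lfunE.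
Qed.

Lemma unitary_imageM U V : U \is unitarymx ->
  unitary_image U (unitary_image (map_mx Num.conj U^T) V) = V.
Proof.
move=> hU; have hU' : (realify U)^T *m realify U = 1%:M.
  by apply: mulmx1C; exact: realify_orthogonal.
apply/vspaceP => v; apply/unitary_imageP/idP.
  move=> [_ /unitary_imageP[w wV ->] ->].
  by rewrite realify_adjoint -mulmxA hU' mulmx1.
move=> vV; exists (v *m (realify U)^T).
  by apply/unitary_imageP; exists v; rewrite ?realify_adjoint.
by rewrite -mulmxA hU' mulmx1.
Qed.

Lemma dim_unitary_image U V : U \is unitarymx -> \dim (unitary_image U V) = \dim V.
Proof.
move=> hU; rewrite /unitary_image limg_dim_eq//; apply/eqP; rewrite -subv0.
apply/subvP => v; rewrite memv_cap memv_ker lfunE/= memv0 => /andP[_ /eqP vU].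
by rewrite -(mulmx1 v) -(realify_orthogonal hU) mulmxA vU mul0mx.
Qed.

Lemma isotropic_unitary_image U V : U \is unitarymx ->
  isotropic V -> isotropic (unitary_image U V).
Proof.
move=> hU iV _ _ /unitary_imageP[v vV ->] /unitary_imageP[w wV ->].
by rewrite omega_realify//; exact: iV.
Qed.

(** [realify U] preserves [omega]. For the converse inclusion the preimage of [W] is its image under
    the adjoint of [U], again isotropic of dimension [m]. *)
Lemma unitary_image_annihilator U z : U \is unitarymx ->
  [set W : Gr | exists2 V : Gr, isotropic_annihilator z V &
      Gh_space W = unitary_image U (Gh_space V)]
  = isotropic_annihilator (z *m realify U).
Proof.
move=> hU; apply/seteqP; split => W.
  move=> [V Vz WV] w; rewrite WV => /unitary_imageP[v vV ->].
  by rewrite omega_realify//; exact: Vz.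
move=> Wz; pose U' := map_mx Num.conj U^T.
have hU' : U' \is unitarymx by rewrite trmxC_unitary.
have /asboolP[isoW dimW] := valP (W : Gh R mn).
have VP : `[< isotropic (unitary_image U' (Gh_space W)) /\
    \dim (unitary_image U' (Gh_space W)) = m >].
  by apply/asboolP; split; [exact: isotropic_unitary_image|rewrite dim_unitary_image].
exists (exist (fun V : {vspace vec} => `[< isotropic V /\ \dim V = m >]) _ VP);
  last by rewrite /Gh_space/= unitary_imageM.
move=> v /unitary_imageP[w wW ->].
rewrite -(omega_realify _ _ hU) -mulmxA realify_adjoint.
have -> : (realify U)^T *m realify U = 1%:M.
  by apply: mulmx1C; exact: realify_orthogonal.
by rewrite mulmx1; exact: Wz.
Qed.

Lemma isotropic_annihilatorZ (c : R) z : c != 0 ->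
  isotropic_annihilator (c *: z) = isotropic_annihilator z.
Proof.
move=> c0; apply/seteqP; split => V h v vV; last by rewrite omegaZr h ?mulr0.
by have /eqP := h v vV; rewrite omegaZr mulf_eq0 (negbTE c0) => /eqP.
Qed.

Lemma annihilator_measure_eq (mu : probability Gr R) z w :
  unitary_invariant mu -> z != 0 -> w != 0 ->
  mu (isotropic_annihilator z) = mu (isotropic_annihilator w).
Proof.
move=> inv z0 w0; have [U [hU [c c0 zU]]] := unitary_transitive z0 w0.
rewrite -(inv U hU _ (measurable_isotropic_annihilator z)).
by rewrite unitary_image_annihilator// zU isotropic_annihilatorZ.
Qed.

Definition moment_vec (i : nat) : vec := \row_k (i%:R ^+ k).

(** Along the moment curve [omega v] is a polynomial in [i]: the second half of [v], negated, gives
    the coefficients of degree below [n], the first half those from [n] on. *)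
Lemma omega_moment v i : omega v (moment_vec i) =
  (rVpoly (row_mx (- rsubmx v) (lsubmx v))).[i%:R].
Proof.
rewrite (@horner_coef_wide _ (n + n)) ?size_poly//.
under eq_bigr do rewrite coef_rVpoly_ord.
rewrite big_split_ord/= /omega -big_split; apply: eq_bigr => j _ /=.
by rewrite row_mxEl row_mxEr !mxE/=; ring.
Qed.

(** Since [0 < m], [V] contains a nonzero [v]; the indices counted are distinct roots of the nonzero
    polynomial attached to [v], of degree below [n + n]. *)
Lemma card_moment_annihilator (V : Gr) (N : nat) : (0 < m)%N ->
  (\sum_(i < N) (V \in isotropic_annihilator (moment_vec i)) <= n + n)%N.
Proof.
move=> m0; have /asboolP[_ dimV] := valP (V : Gh R mn).
pose v := vpick (Gh_space V).
have v0 : v != 0 by rewrite vpick0 -dimv_eq0 [\dim _]dimV -lt0n.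
have vV : v \in Gh_space V by exact: memv_pick.
pose p := rVpoly (row_mx (- rsubmx v) (lsubmx v)).
have p0 : p != 0.
  apply: contra v0 => /eqP p0.
  have : row_mx (- rsubmx v) (lsubmx v) = 0.
    by rewrite -[LHS]rVpolyK -/p p0 linear0.
  rewrite -row_mx0 => /eq_row_mx[/eqP]; rewrite oppr_eq0 => /eqP r0 l0.
  by rewrite -(hsubmxK v) r0 l0 row_mx0.
pose good i := V \in isotropic_annihilator (moment_vec i).
pose s := [seq (i%:R : R) | i <- iota 0 N & good i].
have us : uniq s.
  rewrite map_inj_uniq ?filter_uniq ?iota_uniq// => i j /eqP.
  by rewrite eqr_nat => /eqP.
have rs : all (root p) s.
  rewrite /s all_map; apply/allP => i; rewrite mem_filter => /andP[gi _] /=.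
  rewrite /root -omega_moment; apply/eqP.
  by move: gi; rewrite /good inE; exact.
have := max_poly_roots p0 rs us; rewrite size_map size_filter.
move=> /ltnW /leq_trans/(_ (size_poly _ _)).
rewrite -sum1_count big_mkcond/= -[N in iota 0 N]subn0 big_mkord.
by apply: leq_trans; apply: leq_sum => i _; rewrite /good; case: ifP.
Qed.

Lemma annihilator_measure0 (mu : probability Gr R) z :
  unitary_invariant mu -> (0 < m)%N -> z != 0 ->
  mu (isotropic_annihilator z) = 0%E.
Proof.
move=> inv m0 z0.
have n0 : (0 < n + n)%N by rewrite addn_gt0 (leq_trans m0 mn).
have mom0 i : moment_vec i != 0.
  apply/eqP => /rowP/(_ (Ordinal n0)); rewrite !mxE expr0 => /eqP.
  by rewrite oner_eq0.
have mE i := measurable_isotropic_annihilator (moment_vec i).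
have bound N : ((mu (isotropic_annihilator z)) *+ N <= ((n + n)%:R : R)%:E)%E.
  have -> : (mu (isotropic_annihilator z) *+ N)%E =
      (\sum_(i < N) mu (isotropic_annihilator (moment_vec i)))%E.
    rewrite (eq_bigr (fun=> mu (isotropic_annihilator z))).
      by rewrite sumr_const card_ord.
    by move=> i _; apply: annihilator_measure_eq.
  have intE i : mu (isotropic_annihilator (moment_vec i)) =
      (\int[mu]_V (\1_(isotropic_annihilator (moment_vec i)) V)%:E)%E.
    by rewrite integral_indic// setIT.
  under eq_bigr do rewrite intE.
  (* The sum of the measures is the integral of a counting function bounded by [n + n], and [mu] has
     total mass at most 1. *)
  rewrite -ge0_integral_sum//.
  - apply: (@le_trans _ _ (\int[mu]_V ((n + n)%:R : R)%:E)%E).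
      apply: ge0_le_integral => //.
      + by move=> V _; apply: sume_ge0 => i _; rewrite lee_fin.
      + apply: emeasurable_sum => i; apply/measurable_EFinP.
        exact: measurable_indic.
      + move=> V _; rewrite sumEFin lee_fin.
        have := card_moment_annihilator V N m0; rewrite -(ler_nat R) natr_sum.
        by apply: le_trans; apply: ler_sum => i _; rewrite indicE.
    rewrite integral_cst//.
    by rewrite -[leRHS]mule1 lee_wpmul2l//; exact: probability_le1.
  move=> i; apply/measurable_EFinP; apply: measurable_indic; exact: mE.
have fin : mu (isotropic_annihilator z) \is a fin_num by
  apply: fin_num_measure; exact: measurable_isotropic_annihilator.
apply/eqP; rewrite eq_le measure_ge0 andbT -(fineK fin) lee_fin leNgt.
apply/negP => c0; set c := fine _ in c0.
(* A positive measure [c] is contradicted by any integer above [(n + n)%:R / c]. *)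
have := bound (Num.bound ((n + n)%:R / c)).
rewrite -(fineK fin) -/c -EFin_natmul lee_fin leNgt => /negP; apply.
rewrite -[ltRHS]mulr_natl -ltr_pdivrMr//; apply: archi_boundP.
by rewrite divr_ge0// ltW.
Qed.

End isotropic_null_sets.

(** * Dimensions of the vertical projections *)

Section projection_dimensions.
Context {R : realType} {n : nat}.
Local Notation vec := 'rV[R]_(n + n).
Local Notation H := (heis R n).
Implicit Types (p q : H) (V : {vspace vec}) (A : set H).

Lemma vproj_orthov V p : (vproj V p).1 \in orthov (@dot R (n + n)) V.
Proof. by rewrite /vproj/= addrC; exact: sub_orth_proj_in. Qed.

(** The projection changes the horizontal part by an element of [V], on which [omega v] vanishes by
    isotropy. A lower bound for [omega v] on [A] thus passes to its projection. *)
Lemma omega_vproj V p v : isotropic V -> v \in V ->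
  omega v (vproj V p).1 = omega v p.1.
Proof.
move=> iV vV; rewrite /vproj/= omegaDr omegaNr.
by rewrite (iV _ _ vV (orth_proj_in _ _)) oppr0 add0r.
Qed.

Lemma dim_eucl_le_quotient V A :
  (hausdorff_dim eucl_dist [set vproj V p | p in A] <=
   hausdorff_dim (quotient_dist V) [set vproj V p | p in A])%E.
Proof.
apply: hausdorff_dim_le => s s0; apply: small_covers_eucl => // _ [p _ <-].
exact: vproj_orthov.
Qed.

Lemma dim_quotient_le_eucl V A v (eta : R) : isotropic V -> v \in V -> 0 < eta ->
  (forall p, A p -> eta <= omega v p.1) ->
  (hausdorff_dim (quotient_dist V) [set vproj V p | p in A] <=
   hausdorff_dim eucl_dist [set vproj V p | p in A])%E.
Proof.
move=> iV vV eta0 hA; apply: hausdorff_dim_le => s s0.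
apply: (small_covers_quotient s0 vV eta0) => _ [p Ap <-].
by rewrite omega_vproj//; exact: hA.
Qed.

Lemma omega_gt_ball v p : 0 < omega v p.1 -> exists k : nat,
  forall q, ball p k.+1%:R^-1 q -> omega v p.1 / 2 <= omega v q.1.
Proof.
move=> vp; pose c : R := (2 * n)%:R * l2 v.
have c0 : 0 <= c by rewrite mulr_ge0// l2_ge0.
exists (Num.bound (c / (omega v p.1 / 2))); set k := Num.bound _.
have k0 : 0 < k.+1%:R :> R by [].
have ck : c * k.+1%:R^-1 <= omega v p.1 / 2.
  rewrite ler_pdivrMr// mulrC -ler_pdivrMr ?divr_gt0//.
  apply: ltW; apply: (@lt_trans _ _ k%:R); last by rewrite ltr_nat.
  by apply: archi_boundP; rewrite divr_ge0// ltW// divr_gt0.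
move=> q [[_ pq] _].
have : `|omega v (p.1 - q.1)| <= (2 * n)%:R * (l2 v * k.+1%:R^-1).
  apply: omega_le_coord => i; first exact: coord_le_l2.
  by rewrite !mxE ltW//; exact: pq.
rewrite mulrA -/c omegaDr omegaNr => /(le_trans (ler_norm _))/le_trans/(_ ck).
by move: (omega v p.1) (omega v q.1) => a b; lra.
Qed.

End projection_dimensions.

Theorem lemma3p4 (R : realType) (beta : R) (n m : nat) (alpha : R)
    (beta_ge0 : 0 <= beta) (n_ge1 : (1 <= n)%N) (m_ge1 : (1 <= m)%N)
    (mn : (m <= n)%N) (alpha_ge1 : 1 <= alpha) (alpha_lt : alpha < (2 * n + 1)%:R)
    (mu : probability (GhBorel R mn) R) (mu_inv : unitary_invariant mu) :
  (forall A : set (heis R n), <<s @open (heis R n) >> A ->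
     (alpha%:E < hausdorff_dim eucl_dist A)%E ->
     {ae mu, forall V : GhBorel R mn,
       (beta%:E <= hausdorff_dim (quotient_dist (Gh_space V))
                     [set vproj (Gh_space V) p | p in A])%E})
  <->
  (forall A : set (heis R n), <<s @open (heis R n) >> A ->
     (alpha%:E < hausdorff_dim eucl_dist A)%E ->
     {ae mu, forall V : GhBorel R mn,
       (beta%:E <= hausdorff_dim eucl_dist
                     [set vproj (Gh_space V) p | p in A])%E}).

Proof.
have FF : Filter (nbhs (almost_everywhere mu)).
  exact: (ae_filter_ringOfSetsType mu).
split=> h A mA dimA; last first.
  apply: filterS (h A mA dimA) => V /le_trans; apply.
  exact: dim_eucl_le_quotient.
have [p [p0 pdim]] := exists_concentration_point alpha_ge1 dimA.
pose A_ k := A `&` ball p k.+1%:R^-1.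
(* The radius that works depends on [V], so the exceptional null sets of all countably many radii
   are discarded together beforehand. *)
have aeA : {ae mu, forall V : GhBorel R mn, forall k,
    (beta%:E <= hausdorff_dim (quotient_dist (Gh_space V))
                  [set vproj (Gh_space V) q | q in A_ k])%E}.
  apply: ae_foralln => k; apply: h; last by apply: pdim; rewrite invr_gt0.
  apply: (@measurableI _ (g_sigma_algebraType (@open (heis R n))) A) => //.
  by apply: sub_sigma_algebra; apply: ball_open; rewrite invr_gt0.
have aen : {ae mu, forall V : GhBorel R mn, ~ @isotropic_annihilator R n m mn p.1 V}.
  exists (@isotropic_annihilator R n m mn p.1); split.
  - exact: measurable_isotropic_annihilator.
  - exact: annihilator_measure0.
  - by move=> V /= /contrapT.
apply: filterS2 aeA aen => V dimV nV.
have /asboolP[isoV _] := valP (V : Gh R mn).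
(* The nonvanishing of [omega] gives only some sign; replacing [v] by its opposite makes it
   positive. *)
have [v vV vp] : exists2 v, v \in Gh_space V & 0 < omega v p.1.
  apply: contrapT => nov; apply: nV => v vV; apply/eqP.
  rewrite eq_le; apply/andP; split; rewrite leNgt; apply/negP => o.
    by apply: nov; exists v.
  apply: nov; exists (- v); first by rewrite memvN.
  by rewrite omegaNl oppr_gt0.
have [k hk] := omega_gt_ball vp.
apply: le_trans (dimV k) _.
apply: le_trans (dim_quotient_le_eucl (eta := omega v p.1 / 2) isoV vV _ _) _.
- by rewrite divr_gt0.
- by move=> q [_ /hk].
- by apply: hausdorff_dim_subset => _ [q [Aq _] <-]; exists q.
Qed.
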